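(* The limit $\eta=\lim_{n \to \infty} m(n)^{1/n}$ exists. Furthermore, for any $\epsilon>0$ and $n$ sufficiently large, \[m(n) = \eta^{n\left(1+O\left(\exp\left(-\sqrt{\left(\frac{1}{6}-\epsilon\right)\log n \log \log n}\right)\right)\right)},\] and the constant $\eta$ is effectively computable.
   Context: A set of positive integers is primitive if no element divides another element. A primitive subset $S$ of $\{1,\ldots,n\}$ is maximal if for every $k\in\{1,\ldots,n\}\setminus S$ the set $S\cup\{k\}$ is not primitive. $m(n)$ denotes the number of maximal primitive subsets of $\{1,2,\ldots,n\}$. *)

(* Defs.v *)
From mathcomp Require Import all_boot all_order all_algebra.
From mathcomp Require Import all_classical all_reals all_analysis.

Set Implicit Arguments.
Unset Strict Implicit.
Unset Printing Implicit Defensive.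

Import Order.TTheory GRing.Theory Num.Theory.
Import numFieldNormedType.Exports.

(* Subsets of {1, ..., n} are sets S : {set 'I_n.+1} (elements 0, ..., n)
   contained in [pos_upto n], which leaves out 0. *)
Definition pos_upto (n : nat) : {set 'I_n.+1} := [set k : 'I_n.+1 | 0 < k].

Definition primitive (n : nat) (S : {set 'I_n.+1}) : bool :=
  [forall a in S, forall b in S, (a != b) ==> ~~ (a %| b)].

Definition maximal_primitive (n : nat) (S : {set 'I_n.+1}) : bool :=
  [&& S \subset pos_upto n, primitive S &
      [forall k in pos_upto n :\: S, ~~ primitive (k |: S)]].

Definition num_maximal_primitive (n : nat) : nat :=
  #|[set S : {set 'I_n.+1} | maximal_primitive S]|.

(* The general (total) recursive functions: the smallest class of functions
   nat^k -> nat containing zero, successor and the projections, and closed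
   under composition, primitive recursion, and minimization of regular
   functions (those for which the minimum exists for every argument).  In
   [recursive_prim] and [recursive_mu] the function h is the one determined
   pointwise by the stated equations.  Being an inductive predicate, this does
   not become trivial in the presence of classical choice axioms. *)
Inductive recursive : forall k : nat, (k.-tuple nat -> nat) -> Prop :=
| recursive_zero (k : nat) :
    recursive (fun _ : k.-tuple nat => 0)
| recursive_succ :
    recursive (fun v : 1.-tuple nat => (tnth v ord0).+1)
| recursive_proj (k : nat) (i : 'I_k) :
    recursive (fun v : k.-tuple nat => tnth v i)
| recursive_comp (k l : nat) (f : l.-tuple nat -> nat)
    (g : 'I_l -> k.-tuple nat -> nat) :
    recursive f -> (forall i, recursive (g i)) ->
    recursive (fun v : k.-tuple nat => f [tuple g i v | i < l])
| recursive_prim (k : nat) (f : k.-tuple nat -> nat)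
    (g : k.+2.-tuple nat -> nat) (h : k.+1.-tuple nat -> nat) :
    recursive f -> recursive g ->
    (forall v : k.-tuple nat, h [tuple of 0 :: v] = f v) ->
    (forall (n : nat) (v : k.-tuple nat),
        h [tuple of n.+1 :: v] = g [tuple of n :: h [tuple of n :: v] :: v]) ->
    recursive h
| recursive_mu (k : nat) (f : k.+1.-tuple nat -> nat) (h : k.-tuple nat -> nat) :
    recursive f ->
    (forall v : k.-tuple nat, f [tuple of h v :: v] = 0) ->
    (forall (v : k.-tuple nat) (i : nat),
        i < h v -> f [tuple of i :: v] <> 0) ->
    recursive h.

Definition recursive1 (f : nat -> nat) : Prop :=
  recursive (fun v : 1.-tuple nat => f (tnth v ord0)).

Local Open Scope ring_scope.

(* The integer-valued recursive function k |-> p k - q k gives the numerator of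
   an approximation of x with denominator k + 1 and error at most 1 / (k + 1). *)
Definition computable_real (R : realType) (x : R) : Prop :=
  exists p q : nat -> nat,
    [/\ recursive1 p, recursive1 q &
        forall k : nat,
          `|x - ((p k)%:R - (q k)%:R) / k.+1%:R| <= k.+1%:R^-1].

(* Main.v *)
Require Import Defs.
From mathcomp Require Import all_boot all_order all_algebra.
From mathcomp Require Import zify ring lra.

(* Maximal primitive sets are the maximal independent sets of the divisibility
   graph. Deleting a vertex changes their number by a factor in [1, 2], so
   deleting the numbers up to n / y costs a factor 2 ^ (n / y); the remaining
   edges join numbers whose ratio is y-smooth, and the graph splits into
   components indexed by the y-rough parts r <= n. The component of r only depends
   on n / r, hence ln m(n) is a sum over y-smooth i of bounded gains times the
   number of y-rough integers up to n / i. Legendre's sieve with Rankin's trick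
   makes the latter proportional to n / i, so that ln m(n) / n is a Cauchy sequence
   with error O(1 / y + n ^ (t - 1) E ^ 2), where E is the Euler product of
   1 / (1 - p ^ -t) over p <= y. The error term of the theorem comes from
   ln y ~ sqrt (ln n ln ln n / 6) and 1 - t = ln ln n / (5 ln y).
   Since the rate is explicit and m is recursive, the limit is computable. *)

Set Implicit Arguments.
Unset Strict Implicit.
Unset Printing Implicit Defensive.

(** * Maximal independent sets *)

(** The intermediate constant depends on y, and y has to grow with n, so the argument offers no
    formula for the limit. Instead one y, chosen from n, serves n and every N >= n at once; only
    differences of ln m(n) / n are estimated, and the limit comes from completeness. How fast y may
    grow is decided by the sieve. With an error of 1 for each term, the 2 ^ pi(y) terms of
    inclusion-exclusion would confine y to little more than ln n. With Rankin's exponent t < 1 the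
    term of d has error at most (n / (i d)) ^ t, and summation over d and over smooth i costs one
    factor E each, hence n ^ t E ^ 2. This admits ln y of order sqrt (ln n ln ln n). To bound E it
    is enough to know the sum of p ^ -t over the primes p <= y up to a factor sqrt (ln y), so an
    elementary estimate of that sum suffices. *)

Definition mis_set (T : finType) (e : rel T) (V S : {set T}) : bool :=
  [&& S \subset V, [forall a in S, forall b in S, ~~ e a b] &
      [forall k in V :\: S, exists b in S, e k b]].

Definition mis (T : finType) (e : rel T) (V : {set T}) : nat :=
  #|[set S | mis_set e V S]|.

Lemma mis_setP (T : finType) (e : rel T) (V S : {set T}) :
  reflect [/\ {subset S <= V}, {in S &, forall a b, ~~ e a b} &
              forall k, k \in V -> k \notin S -> exists2 b, b \in S & e k b]
          (mis_set e V S).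
Proof.
apply: (iffP and3P) => -[h1 h2 h3]; split.
- exact/subsetP.
- by move=> a b aS bS; move/forall_inP: h2 => /(_ a aS)/forall_inP/(_ b bS).
- move=> k kV kS; have kVS : k \in V :\: S by rewrite inE kS kV.
  by move/forall_inP: h3 => /(_ k kVS)/exists_inP.
- exact/subsetP.
- by apply/forall_inP => a aS; apply/forall_inP => b bS; exact: h2.
- by apply/forall_inP => k; rewrite inE => /andP[kS kV]; apply/exists_inP/h3.
Qed.

(** Invariance under relabelling. It serves to change the bound of an ordinal type, to multiply all
    vertices by a fixed number, and, with the identity, to replace the edge relation. *)
Lemma mis_imset (T T' : finType) (f : T -> T') (e : rel T) (e' : rel T')
    (V : {set T}) :
  {in V &, injective f} -> {in V &, forall a b, e' (f a) (f b) = e a b} ->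
  mis e' (f @: V) = mis e V.
Proof.
move=> finj fe; rewrite /mis.
have -> : [set S | mis_set e' (f @: V) S] =
          (fun S : {set T} => f @: S) @: [set S | mis_set e V S].
  apply/setP => S'; apply/idP/imsetP.
  - rewrite inE => /mis_setP[sub ind mx].
    have fS : f @: (V :&: f @^-1: S') = S'.
      apply/setP => x; apply/imsetP/idP => [[a]|xS].
        by rewrite !inE => /andP[_ aS] ->.
      have /imsetP[a aV xE] := sub x xS.
      by exists a => //; rewrite !inE aV -xE.
    exists (V :&: f @^-1: S'); last by rewrite fS.
    rewrite inE; apply/mis_setP; split.
    + by move=> a; rewrite inE => /andP[].
    + move=> a b; rewrite !inE => /andP[aV aS] /andP[bV bS].
      by rewrite -fe //; exact: ind.
    + move=> k kV; rewrite !inE kV /= => kS.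
      have [|b bS kb] := mx (f k) _ kS; first exact: imset_f.
      have /imsetP[c cV bE] := sub b bS.
      by exists c; [rewrite !inE cV -bE | rewrite -fe // -bE].
  - move=> [S]; rewrite inE => /mis_setP[sub ind mx] ->.
    rewrite inE; apply/mis_setP; split.
    + by move=> x /imsetP[a aS ->]; apply/imset_f/sub.
    + move=> _ _ /imsetP[a aS ->] /imsetP[b bS ->].
      by rewrite fe ?sub //; exact: ind.
    + move=> _ /imsetP[k kV ->] kS.
      have [|b bS kb] := mx k kV; first by apply: contra kS; exact: imset_f.
      by exists (f b); rewrite ?imset_f // fe // sub.
rewrite card_in_imset // => S1 S2; rewrite !inE.
move=> /mis_setP[sub1 _ _] /mis_setP[sub2 _ _] eqf.
apply/setP => a; apply/idP/idP => aS.
- have : f a \in f @: S2 by rewrite -eqf imset_f.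
  by case/imsetP => b bS /(finj _ _ (sub1 a aS) (sub2 b bS))->.
- have : f a \in f @: S1 by rewrite eqf imset_f.
  by case/imsetP => b bS /(finj _ _ (sub2 a aS) (sub1 b bS))->.
Qed.

Lemma eq_in_mis (T : finType) (e e' : rel T) (V : {set T}) :
  {in V &, e =2 e'} -> mis e V = mis e' V.
Proof.
move=> ee'; rewrite -[V in LHS](imset_id V); apply: mis_imset => //.
Qed.

Lemma mis_set0 (T : finType) (e : rel T) : mis e set0 = 1.
Proof.
rewrite /mis (_ : [set S | _] = [set set0]) ?cards1 //.
apply/setP => S; rewrite !inE; apply/mis_setP/eqP => [[sub _ _]|->].
  by apply/setP => x; rewrite inE; apply/negP => /sub; rewrite inE.
by split=> [x|a b|k]; rewrite ?inE.
Qed.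

(** Without edges across, the neighbour that blocks a vertex [k] lies on the side of [k], so
    intersecting with [V1] and [V2] turns maximal sets of the union into pairs of maximal sets. *)
Lemma mis_setU (T : finType) (e : rel T) (V1 V2 : {set T}) :
  [disjoint V1 & V2] ->
  (forall a b, a \in V1 -> b \in V2 -> ~~ e a b && ~~ e b a) ->
  mis e (V1 :|: V2) = mis e V1 * mis e V2.
Proof.
move=> dis ne; rewrite -cardsX.
have n12 x : x \in V1 -> x \in V2 = false by move=> h; exact: (disjointFr dis).
have n21 x : x \in V2 -> x \in V1 = false by move=> h; exact: (disjointFl dis).
have restr (S1 S2 : {set T}) : {subset S1 <= V1} -> {subset S2 <= V2} ->
    (V1 :&: (S1 :|: S2) = S1) * (V2 :&: (S1 :|: S2) = S2).
  move=> s1 s2; split; apply/setP => x; rewrite !inE.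
    case xV: (x \in V1) => /=.
      by rewrite orbC; case: (boolP (x \in S2)) => // /s2; rewrite n12.
    by apply/esym/negP => /s1; rewrite xV.
  case xV: (x \in V2) => /=.
    by case: (boolP (x \in S1)) => // /s1; rewrite n21.
  by apply/esym/negP => /s2; rewrite xV.
rewrite -(@card_in_imset _ _ (fun p => p.1 :|: p.2)); last first.
  move=> [A1 A2] [B1 B2]; rewrite !inE /=.
  move=> /andP[/mis_setP[a1 _ _] /mis_setP[a2 _ _]].
  move=> /andP[/mis_setP[b1 _ _] /mis_setP[b2 _ _]] AB.
  congr pair.
    by rewrite -(restr _ _ a1 a2).1 AB (restr _ _ b1 b2).
  by rewrite -(restr _ _ a1 a2).2 AB (restr _ _ b1 b2).
apply: eq_card => S; rewrite inE; apply/mis_setP/imsetP.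
- move=> [sub ind mx]; exists (V1 :&: S, V2 :&: S) => /=; last first.
    by rewrite -setIUl; apply/esym/setIidPr/subsetP.
  rewrite !inE /=; apply/andP; split; apply/mis_setP; split.
  + by move=> x; rewrite inE => /andP[].
  + by move=> a b; rewrite !inE => /andP[_ +] /andP[_]; exact: ind.
  + move=> k kV; rewrite inE kV /= => kS.
    have [|b bS kb] := mx k _ kS; first by rewrite inE kV.
    exists b => //; rewrite inE bS andbT.
    have := sub b bS; rewrite inE => /orP[//|bV2].
    by have := ne _ _ kV bV2; rewrite kb.
  + by move=> x; rewrite inE => /andP[].
  + by move=> a b; rewrite !inE => /andP[_ +] /andP[_]; exact: ind.
  + move=> k kV; rewrite inE kV /= => kS.
    have [|b bS kb] := mx k _ kS; first by rewrite inE kV orbT.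
    exists b => //; rewrite inE bS andbT.
    have := sub b bS; rewrite inE => /orP[bV1|//].
    by have := ne _ _ bV1 kV; rewrite kb andbF.
- move=> [[S1 S2]]; rewrite !inE /=.
  move=> /andP[/mis_setP[s1 i1 m1] /mis_setP[s2 i2 m2]] ->; split.
  + by move=> x; rewrite !inE => /orP[/s1->|/s2->]; rewrite ?orbT.
  + move=> a b; rewrite !inE => /orP[a1|a2] /orP[b1|b2].
    * exact: i1.
    * by have /andP[] := ne a b (s1 a a1) (s2 b b2).
    * by have /andP[] := ne b a (s1 b b1) (s2 a a2).
    * exact: i2.
  + move=> k; rewrite !inE negb_or => /orP[kV|kV] /andP[k1 k2].
    * by have [b bS kb] := m1 k kV k1; exists b => //; rewrite inE bS.
    * by have [b bS kb] := m2 k kV k2; exists b => //; rewrite inE bS orbT.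
Qed.

(** The labelling [g] is constant on connected components. The list [s] may contain labels that do
    not occur in [V]: their fibres are empty and contribute the factor 1. *)
Lemma mis_fibers (T : finType) (I : eqType) (g : T -> I) (e : rel T)
    (s : seq I) (V : {set T}) :
  (forall a b, e a b -> g a = g b) -> uniq s -> {in V, forall a, g a \in s} ->
  mis e V = \prod_(i <- s) mis e [set a in V | g a == i].
Proof.
move=> eg; elim: s V => [|i s IHs] V /=.
  move=> _ gs; rewrite big_nil (_ : V = set0) ?mis_set0 //.
  by apply/setP => a; rewrite inE; apply/negP => /gs.
move=> /andP[is_ us] gs; rewrite big_cons.
have VE : V = [set a in V | g a == i] :|: [set a in V | g a != i].
  by apply/setP => a; rewrite !inE -andb_orr orbN andbT.
rewrite {1}VE mis_setU.
- congr (_ * _); rewrite IHs //.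
    rewrite big_seq [RHS]big_seq; apply: eq_bigr => j js; congr mis.
    apply/setP => a; rewrite !inE -andbA; congr (_ && _).
    by apply: andb_idl => /eqP->; apply: contraNneq is_ => <-.
  move=> a; rewrite inE => /andP[aV ai].
  by have := gs a aV; rewrite inE (negPf ai).
- by apply/pred0P => a /=; rewrite !inE; case: (g a == i); rewrite ?andbF.
- move=> a b; rewrite !inE => /andP[_ /eqP ga] /andP[_ gb].
  by apply/andP; split; apply: contraNN gb => /eg; rewrite ga => ->.
Qed.

(* If [S] is maximal in [V :\ v], exactly one of [S] and [v |: S] is maximal in
   [V]. *)
Lemma mis_setD1_le (T : finType) (e : rel T) (V : {set T}) (v : T) :
  symmetric e -> irreflexive e -> mis e (V :\ v) <= mis e V.
Proof.
move=> esym eirr.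
have [vV|vV] := boolP (v \in V); last first.
  suff -> : V :\ v = V by [].
  apply/setP => x; rewrite !inE andb_idl // => xV.
  by apply: contraNneq vV => <-.
pose f (S : {set T}) := if [exists b in S, e v b] then S else v |: S.
have vS S : mis_set e (V :\ v) S -> v \notin S.
  by move=> /mis_setP[sub _ _]; apply/negP => /sub; rewrite !inE eqxx.
have fK (S : {set T}) : v \notin S -> f S :\ v = S.
  move=> vnS; rewrite /f; case: ifP => _; last by rewrite setU1K.
  by apply/setP => x; rewrite !inE andb_idl // => xS; apply: contraNneq vnS => <-.
rewrite /mis -(@card_in_imset _ _ f); last first.
  by move=> A B; rewrite !inE => /vS vA /vS vB fAB; rewrite -(fK A) // fAB fK.
apply/subset_leq_card/subsetP => _ /imsetP[S + ->]; rewrite !inE => mS.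
have vnS := vS S mS; move: mS => /mis_setP[sub ind mx].
have subV x : x \in S -> x \in V by move=> /sub; rewrite !inE => /andP[].
rewrite /f; case: ifPn => [/exists_inP[b bS vb]|/exists_inPn nvb].
- apply/mis_setP; split => // k kV kS.
  have [->|kv] := eqVneq k v; first by exists b.
  by apply: mx; rewrite // !inE kv.
- apply/mis_setP; split.
  + by move=> x; rewrite !inE => /orP[/eqP->//|/subV].
  + move=> a b; rewrite !inE => /orP[/eqP->|aS] /orP[/eqP->|bS].
    * by rewrite eirr.
    * exact: nvb.
    * by rewrite esym; exact: nvb.
    * exact: ind.
  + move=> k kV; rewrite !inE negb_or => /andP[kv kS].
    have [|b bS kb] := mx k _ kS; first by rewrite !inE kv.
    by exists b => //; rewrite !inE bS orbT.
Qed.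

Lemma mis_subset (T : finType) (e : rel T) (V' V : {set T}) :
  symmetric e -> irreflexive e -> V' \subset V -> mis e V' <= mis e V.
Proof.
move=> esym eirr; move: {2}_.+1 (ltnSn #|V :\: V'|) => m.
elim: m V => // m IHm V ltm sub.
have [VV|/set0Pn[v]] := eqVneq (V :\: V') set0.
  suff -> : V' = V by [].
  by apply/eqP; rewrite eqEsubset sub -setD_eq0 VV eqxx.
rewrite inE => /andP[vV' vV].
apply: (leq_trans _ (mis_setD1_le V v esym eirr)); apply: IHm; last first.
  apply/subsetP => x xV'; rewrite !inE (subsetP sub) // andbT.
  by apply: contraNneq vV' => <-.
rewrite ltnS in ltm; apply: leq_trans ltm; apply: proper_card; apply/properP; split.
  by apply/subsetP => x; rewrite !inE => /and3P[-> _ ->].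
by exists v; rewrite !inE ?vV ?vV' ?eqxx.
Qed.

(* A maximal set containing [v] is maximal in the graph without the closed
   neighbourhood of [v], once [v] is deleted from it. *)
Lemma mis_le_setD1 (T : finType) (e : rel T) (V : {set T}) (v : T) :
  symmetric e -> irreflexive e -> mis e V <= 2 * mis e (V :\ v).
Proof.
move=> esym eirr; rewrite mul2n -addnn /mis.
set M := [set S | mis_set e V S].
rewrite -(cardsID [set S : {set T} | v \in S] M); apply: leq_add; last first.
  apply/subset_leq_card/subsetP => S; rewrite !inE => /andP[vS].
  move=> /mis_setP[sub ind mx]; apply/mis_setP; split => //.
    by move=> x xS; rewrite !inE sub // andbT; apply: contraNneq vS => <-.
  by move=> k; rewrite !inE => /andP[_ kV]; exact: mx.
pose V' := [set u in V | (u != v) && ~~ e v u].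
have V'V : V' \subset V :\ v.
  by apply/subsetP => x; rewrite !inE => /and3P[-> -> _].
apply: leq_trans (mis_subset esym eirr V'V); rewrite /mis.
rewrite -(@card_in_imset _ _ (fun S => S :\ v)); last first.
  move=> A B; rewrite !inE => /andP[_ vA] /andP[_ vB] AB.
  by rewrite -(setD1K vA) AB setD1K.
apply/subset_leq_card/subsetP => _ /imsetP[S + ->]; rewrite !inE.
move=> /andP[/mis_setP[sub ind mx] vS]; apply/mis_setP; split.
- move=> x; rewrite !inE => /andP[xv xS]; rewrite sub // xv /=.
  exact: ind.
- by move=> a b; rewrite !inE => /andP[_ aS] /andP[_ bS]; exact: ind.
- move=> k; rewrite !inE => /and3P[kV kv vk]; rewrite kv /= => kS.
  have [b bS kb] := mx k kV kS; exists b => //; rewrite !inE bS andbT.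
  by apply: contraNneq vk => <-; rewrite esym.
Qed.

Lemma mis_le_subset (T : finType) (e : rel T) (V' V : {set T}) :
  symmetric e -> irreflexive e -> V' \subset V ->
  mis e V <= 2 ^ #|V :\: V'| * mis e V'.
Proof.
move=> esym eirr; elim: {V'}_.+1 {-2}V' (ltnSn #|V :\: V'|) => // m IHm V' ltm sub.
have [VV|/set0Pn[v]] := eqVneq (V :\: V') set0.
  suff -> : V' = V by rewrite setDv cards0 mul1n.
  by apply/eqP; rewrite eqEsubset sub -setD_eq0 VV eqxx.
rewrite inE => /andP[vV' vV].
have cE : #|V :\: V'| = #|V :\: (v |: V')|.+1.
  rewrite (cardsD1 v) !inE vV vV' add1n; congr (_.+1).
  by apply: eq_card => x; rewrite !inE negb_or andbA.
rewrite cE expnS -mulnA mulnCA; apply: leq_trans (IHm (v |: V') _ _) _.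
- by rewrite -cE.
- by rewrite subUset sub1set vV.
- rewrite leq_mul2l; apply/orP; right.
  by have := mis_le_setD1 (v |: V') v esym eirr; rewrite setU1K.
Qed.

(** * The divisibility graph *)

Definition dvd_adj (a b : nat) : bool := (a != b) && ((a %| b) || (b %| a)).

Lemma dvd_adj_sym : symmetric dvd_adj.
Proof. by move=> a b; rewrite /dvd_adj eq_sym orbC. Qed.

Lemma dvd_adj_irr : irreflexive dvd_adj.
Proof. by move=> a; rewrite /dvd_adj eqxx. Qed.

Definition dvd_graph (n : nat) : rel 'I_n.+1 := fun a b => dvd_adj a b.
Arguments dvd_graph : clear implicits.

Lemma dvd_graph_sym (n : nat) : symmetric (dvd_graph n).
Proof. by move=> a b; exact: dvd_adj_sym. Qed.

Lemma dvd_graph_irr (n : nat) : irreflexive (dvd_graph n).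
Proof. by move=> a; exact: dvd_adj_irr. Qed.

Lemma primitiveP (n : nat) (S : {set 'I_n.+1}) :
  reflect {in S &, forall a b, ~~ dvd_graph n a b} (primitive S).
Proof.
apply: (iffP forall_inP) => [h a b aS bS|h a aS].
  rewrite /dvd_graph /dvd_adj negb_and -implybE negb_or.
  apply/implyP => ab; apply/andP; split.
    by have /forall_inP/(_ b bS)/implyP/(_ ab) := h a aS.
  by have /forall_inP/(_ a aS)/implyP := h b bS; rewrite eq_sym; apply.
apply/forall_inP => b bS; apply/implyP => ab.
by have := h a b aS bS; rewrite /dvd_graph /dvd_adj ab negb_or => /andP[].
Qed.

Lemma num_maximal_primitiveE (n : nat) :
  num_maximal_primitive n = mis (dvd_graph n) (pos_upto n).
Proof.
apply: eq_card => S; rewrite !inE; apply/and3P/mis_setP.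
- move=> [/subsetP sub /primitiveP prim /forall_inP mx]; split=> // k kV kS.
  have /mx : k \in pos_upto n :\: S by rewrite inE kS.
  move=> np; apply/exists_inP; apply: contraNT np => /exists_inPn kb.
  apply/primitiveP => a b; rewrite !inE => /orP[/eqP->|aS] /orP[/eqP->|bS].
  + by rewrite dvd_graph_irr.
  + exact: kb.
  + by rewrite dvd_graph_sym; exact: kb.
  + exact: prim.
- move=> [sub prim mx]; split; [exact/subsetP | exact/primitiveP |].
  apply/forall_inP => k; rewrite inE => /andP[kS kV].
  have [b bS kb] := mx k kV kS; apply/primitiveP => h.
  by have := h k b (setU11 _ _) (setU1r _ bS); rewrite kb.
Qed.

(** * Components of smooth ratio *)

Definition upto (y : nat) : nat_pred := [pred p | p <= y].

(** The model of a component: its vertices are the smooth cofactors of a fixed rough part. The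
    vertex 0 is left out because [pnat] is false at 0. *)
Definition mis_smooth (y i : nat) : nat :=
  mis (dvd_graph i) [set s : 'I_i.+1 | (upto y).-nat s].

Lemma pnat_dvd_lt (y d : nat) : 0 < d -> d <= y -> (upto y).-nat d.
Proof.
move=> d0 dy; apply/pnatP => // p _ pd; rewrite inE /=.
exact: leq_trans (dvdn_leq d0 pd) dy.
Qed.

Lemma pnat_gt0 (pi : nat_pred) (d : nat) : pi.-nat d -> 0 < d.
Proof. by case/andP. Qed.

Lemma mis_smooth0 (y : nat) : mis_smooth y 0 = 1.
Proof.
rewrite /mis_smooth (_ : [set s | _] = set0) ?mis_set0 //.
by apply/setP => s; rewrite !inE ord1.
Qed.

(** Realizes the step from [i] to [i.+1] as the deletion of one vertex inside a single ordinal type,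
    so that the bounds for deletions apply to it. *)
Lemma mis_smooth_setD1 (y i : nat) :
  mis_smooth y i =
  mis (dvd_graph i.+1) ([set s : 'I_i.+2 | (upto y).-nat s] :\ ord_max).
Proof.
rewrite /mis_smooth -(@mis_imset _ _ (widen_ord (leqnSn i.+1)) _ (dvd_graph i.+1)).
- congr mis; apply/setP => s; apply/imsetP/idP => [[t]|].
    by rewrite !inE => ht ->; rewrite ht andbT -val_eqE /= ltn_eqF // ltn_ord.
  rewrite !inE -val_eqE /= => /andP[si hs].
  have lts : s < i.+1 by rewrite ltn_neqAle si -ltnS ltn_ord.
  by exists (Ordinal lts); rewrite ?inE //; apply: val_inj.
- by move=> a b _ _ /(congr1 val) /= /val_inj.
- by [].
Qed.

Lemma mis_smooth_leS (y i : nat) : mis_smooth y i <= mis_smooth y i.+1.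
Proof.
rewrite mis_smooth_setD1.
exact: mis_setD1_le (@dvd_graph_sym _) (@dvd_graph_irr _).
Qed.

Lemma mis_smoothS_le (y i : nat) : mis_smooth y i.+1 <= 2 * mis_smooth y i.
Proof.
rewrite [mis_smooth y i]mis_smooth_setD1.
exact: mis_le_setD1 (@dvd_graph_sym _) (@dvd_graph_irr _).
Qed.

Lemma mis_smoothS_id (y i : nat) :
  ~~ (upto y).-nat i.+1 -> mis_smooth y i.+1 = mis_smooth y i.
Proof.
move=> ni; rewrite [RHS]mis_smooth_setD1; congr mis; apply/setP => s; rewrite !inE.
by rewrite andb_idl //; apply: contraTneq => ->.
Qed.

Lemma mis_smooth_gt0 (y i : nat) : 0 < mis_smooth y i.
Proof.
elim: i => [|i IHi]; first by rewrite mis_smooth0.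
exact: leq_trans (mis_smooth_leS y i).
Qed.

(** A number with rough part [r] is [r * s] for a unique smooth [s]; it is at most [n] exactly when
    [s <= n %/ r], and cancelling [r] preserves divisibility both ways. *)
Lemma mis_component (y n r : nat) : (upto y)^'.-nat r ->
  mis (dvd_graph n) [set a in pos_upto n | (a : nat)`_(upto y)^' == r] =
  mis_smooth y (n %/ r).
Proof.
move=> rr; have r0 := pnat_gt0 rr.
have lerm (s : 'I_(n %/ r).+1) : r * s < n.+1.
  by rewrite ltnS mulnC -leq_divRL // -ltnS.
rewrite /mis_smooth -(@mis_imset _ _ (fun s => Ordinal (lerm s)) _ (dvd_graph n)).
- congr mis; apply/setP => a; apply/idP/imsetP.
    rewrite !inE => /andP[a0 /eqP ar].
    have aE : (a : nat)`_(upto y) * r = a by rewrite -ar partnC.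
    have lts : (a : nat)`_(upto y) < (n %/ r).+1.
      by rewrite ltnS leq_divRL // aE -ltnS.
    exists (Ordinal lts); first by rewrite inE /= part_pnat.
    by apply: val_inj; rewrite /= mulnC aE.
  move=> [s]; rewrite !inE => ss ->; rewrite /= muln_gt0 r0 (pnat_gt0 ss) /=.
  rewrite partnM ?(pnat_gt0 ss) // (part_pnat_id rr) part_p'nat ?muln1 //.
  by rewrite pnatNK.
- move=> s t _ _ /(congr1 val)/eqP; rewrite /= eqn_pmul2l // => /eqP.
  exact: val_inj.
- by move=> s t _ _; rewrite /dvd_graph /dvd_adj /= eqn_pmul2l // !dvdn_pmul2l.
Qed.

(* Deleting the numbers up to [n / y] destroys all edges whose ratio is at least
   [y]; every other edge [a | b] has a [y]-smooth ratio, hence joins two numbers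
   with the same part prime to all [p <= y]. *)
Lemma num_maximal_primitive_rough (y n : nat) : 0 < y ->
  let P := \prod_(1 <= r < n.+1 | (upto y)^'.-nat r) mis_smooth y (n %/ r) in
  num_maximal_primitive n <= 2 ^ (n %/ y) * P /\
  P <= 2 ^ (n %/ y) * num_maximal_primitive n.
Proof.
move=> y0 P.
(* [h] drops the edges between different rough parts. It splits on all of [V] and coincides with
   divisibility on [V'], so both counts on [V] are compared with the same count on [V'], each at the
   cost of deleting [V :\: V']. *)
pose h : rel 'I_n.+1 := fun a b =>
  dvd_adj a b && ((a : nat)`_(upto y)^' == (b : nat)`_(upto y)^').
have hsym : symmetric h by move=> a b; rewrite /h dvd_adj_sym eq_sym.
have hirr : irreflexive h by move=> a; rewrite /h dvd_adj_irr.
pose V := pos_upto n; pose V' := [set a in V | n < a * y].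
have V'V : V' \subset V by apply/subsetP => a; rewrite inE => /andP[].
have cardV : #|V :\: V'| <= n %/ y.
  pose f (a : 'I_n.+1) : nat := a.-1.
  rewrite cardE -(size_map f) -[leqRHS](size_iota 0); apply: uniq_leq_size.
    rewrite map_inj_in_uniq ?enum_uniq // => a b.
    rewrite !mem_enum !inE => /andP[_ a0] /andP[_ b0] fab; apply: val_inj => /=.
    by rewrite -(prednK a0) -(prednK b0) -/(f a) -/(f b) fab.
  move=> _ /mapP[a + ->]; rewrite mem_enum !inE mem_iota /= add0n => /andP[+ a0].
  rewrite a0 /= -leqNgt -leq_divRL // => ay.
  by rewrite /f prednK.
have hV' : mis (dvd_graph n) V' = mis h V'.
  apply: eq_in_mis => a b; rewrite !inE => /andP[a0 ay] /andP[b0 by_].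
  rewrite /h /dvd_graph; case ab: (dvd_adj a b) => //=; apply/esym.
  wlog dab : a b a0 b0 ay by_ ab / a %| b.
    move=> H; have /andP[_ /orP[]] := ab => d; first exact: H.
    by rewrite eq_sym H // dvd_adj_sym.
  have q0 : 0 < b %/ a by rewrite divn_gt0 // dvdn_leq.
  have q1 : (b %/ a)`_(upto y)^' = 1.
    apply: part_p'nat; rewrite pnatNK; apply: pnat_dvd_lt => //.
    rewrite -(leq_pmul2r a0) divnK // mulnC; apply: leq_trans (ltnW ay).
    by rewrite -ltnS.
  by rewrite -[in X in _ == X](divnK dab) partnM // q1 mul1n eqxx.
have PE : P = mis h V.
  rewrite (@mis_fibers _ _ (fun a : 'I_n.+1 => (a : nat)`_(upto y)^') h (index_iota 1 n.+1)).
  - rewrite /P big_mkcond; apply: eq_bigr => r _; case: ifPn => rr.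
      rewrite -mis_component //; apply: eq_in_mis => a b.
      by rewrite !inE /h => /andP[_ /eqP->] /andP[_ /eqP->]; rewrite eqxx andbT.
    rewrite (_ : [set a in V | _] = set0) ?mis_set0 //.
    apply/setP => a; rewrite !inE; apply/negP => /andP[a0 /eqP ar].
    by rewrite -ar part_pnat in rr.
  - by move=> a b /andP[_ /eqP].
  - exact: iota_uniq.
  - move=> a; rewrite inE => a0; rewrite mem_index_iota part_gt0 /=.
    by rewrite ltnS (leq_trans (dvdn_leq a0 (dvdn_part _ _))) // -ltnS.
rewrite PE num_maximal_primitiveE -/V; split.
- apply: leq_trans (mis_le_subset (@dvd_graph_sym n) (@dvd_graph_irr n) V'V) _.
  by rewrite hV' leq_mul ?leq_exp2l ?mis_subset.
- apply: leq_trans (mis_le_subset hsym hirr V'V) _; rewrite -hV'.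
  rewrite leq_mul ?leq_exp2l //.
  exact: mis_subset (@dvd_graph_sym n) (@dvd_graph_irr n) V'V.
Qed.

(* The pairs [{a, 2a}] with [2k < a <= 3k] induce a perfect matching. *)
Lemma num_maximal_primitive_ge (n : nat) :
  2 ^ (n %/ 6) <= num_maximal_primitive n.
Proof.
set k := n %/ 6; have kn : k * 6 <= n by rewrite leq_trunc_div.
pose g (a : 'I_n.+1) : nat := if 3 * k < a then a./2 else a.
pose V := [set a : 'I_n.+1 | (2 * k < g a <= 3 * k) &&
                            ((3 * k < a) ==> ~~ odd a)].
have VP : V \subset pos_upto n.
  apply/subsetP => a; rewrite !inE /g.
  by case: ifP => _ /andP[/andP[+ _] _]; case: (nat_of_ord a).
rewrite num_maximal_primitiveE.
apply: leq_trans (mis_subset (@dvd_graph_sym n) (@dvd_graph_irr n) VP).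
(* All elements of [V] lie above [2 * k] and are at most [6 * k], so a ratio of 3 or more is
   impossible and every proper divisibility in [V] is a doubling. *)
have dV (a b : 'I_n.+1) : a \in V -> b \in V -> a < b -> a %| b ->
    b = a.*2 :> nat /\ a <= 3 * k.
  rewrite !inE /g => + + + /dvdnP[c cE].
  have [c2|c2] := leqP c 2; last first.
    have := leq_mul c2 (leqnn a); rewrite -cE.
    by case: ifP => a3; case: ifP => b3 /=; lia.
  by case: c c2 cE => [|[|[|//]]] _ cE; case: ifP => a3; case: ifP => b3 /=; lia.
pose h : rel 'I_n.+1 := fun a b => dvd_adj a b && (g a == g b).
have -> : mis (dvd_graph n) V = mis h V.
  apply: eq_in_mis => a b aV bV; rewrite /h /dvd_graph.
  case ab: (dvd_adj a b) => //=; apply/esym.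
  wlog dab : a b aV bV ab / a %| b.
    move=> H; have /andP[_ /orP[]] := ab => d; first exact: H.
    by rewrite eq_sym H // dvd_adj_sym.
  have b0 : 0 < b by have := subsetP VP b bV; rewrite inE.
  have ltab : a < b.
    by rewrite ltn_neqAle dvdn_leq // andbT; case/andP: ab.
  have [bE a3] := dV a b aV bV ltab dab.
  move: aV bV; rewrite !inE /g [3 * k < a]ltnNge a3 /= => /andP[/andP[a2 _] _].
  by case: ifP => b3 _; apply/eqP; lia.
rewrite (@mis_fibers _ _ g h (index_iota (2 * k).+1 (3 * k).+1)).
- have -> : 2 ^ k = \prod_(i <- index_iota (2 * k).+1 (3 * k).+1) 2.
    by rewrite prod_nat_const_nat; congr (_ ^ _); lia.
  rewrite [leqLHS]big_seq [leqRHS]big_seq; apply: leq_prod => a.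
  rewrite mem_index_iota ltnS => /andP[ka ak].
  have lta : a < n.+1 by lia.
  have lt2a : a.*2 < n.+1 by lia.
  pose u := Ordinal lta; pose v := Ordinal lt2a.
  have uv : u != v by rewrite -val_eqE /=; lia.
  have gu : g u = a by rewrite /g /= ltnNge ak.
  have gv : g v = a by rewrite /g /= ifT ?doubleK //; lia.
  have adj : h u v.
    rewrite /h gu gv eqxx andbT /dvd_adj val_eqE uv /=.
    by rewrite -muln2 dvdn_mulr.
  have hirr x : ~~ h x x by rewrite /h dvd_adj_irr.
  have hsym x y : h x y = h y x by rewrite /h dvd_adj_sym eq_sym.
  have VaE : [set x in V | g x == a] = [set u; v].
    apply/setP => x; rewrite !inE -!val_eqE /=; apply/idP/idP.
      rewrite /g; case: ifP => x3 /andP[/andP[_ o] /eqP xa]; last by rewrite xa eqxx.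
      by apply/orP; right; apply/eqP; rewrite -xa; move: o => /=; lia.
    case/orP => /eqP xE.
      have -> : x = u by apply: val_inj.
      by rewrite gu /= eqxx ka ak ltnNge ak.
    have -> : x = v by apply: val_inj.
    by rewrite gv /= eqxx ka ak odd_double implybT.
  have <- : #|[set [set u]; [set v]]| = 2.
    rewrite cards2; case: eqP => // /setP/(_ u).
    by rewrite !inE eqxx (negPf uv).
  rewrite VaE; apply/subset_leq_card/subsetP => S; rewrite !inE => /orP[]/eqP->.
    apply/mis_setP; split => [x|x z|x]; rewrite !inE.
    + by move->.
    + by move=> /eqP-> /eqP->.
    + by move=> /orP[/eqP->|/eqP-> _]; rewrite ?eqxx //; exists u; rewrite ?inE // hsym.
  apply/mis_setP; split => [x|x z|x]; rewrite !inE.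
  + by move->; rewrite orbT.
  + by move=> /eqP-> /eqP->.
  + by move=> /orP[/eqP-> _|/eqP->]; rewrite ?eqxx //; exists v; rewrite ?inE.
- by move=> a b /andP[_ /eqP].
- exact: iota_uniq.
- by move=> a; rewrite inE => /andP[ga _]; rewrite mem_index_iota ltnS.
Qed.

(** Together with the preceding lower bound this keeps ln m(n) / n between positive constants for
    large n. The lower one gives eta > 1, so that m(n) can be written as a power of eta at all. *)
Lemma num_maximal_primitive_le (n : nat) : num_maximal_primitive n <= 2 ^ n.+1.
Proof.
apply: leq_trans (max_card _) _.
by rewrite -cardsT -powersetT card_powerset cardsT card_ord.
Qed.

From mathcomp Require Import boolp.

(** * Recursiveness of the counting function *)

Lemma eq_recursive (k : nat) (f g : k.-tuple nat -> nat) :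
  f =1 g -> recursive f -> recursive g.
Proof. by move=> /funext->. Qed.

Definition recursive2 (f : nat -> nat -> nat) : Prop :=
  recursive (fun v : 2.-tuple nat => f (tnth v (inord 0)) (tnth v (inord 1))).

Definition recursive3 (f : nat -> nat -> nat -> nat) : Prop :=
  recursive (fun v : 3.-tuple nat =>
    f (tnth v (inord 0)) (tnth v (inord 1)) (tnth v (inord 2))).

(** The composition rules take inner functions of arbitrary arity, so that a proof of recursiveness
    follows the syntax of the expression, with projections and constants at the leaves. *)
Lemma recursive1_comp (k : nat) (f : nat -> nat) (g : k.-tuple nat -> nat) :
  recursive1 f -> recursive g -> recursive (fun v => f (g v)).
Proof.
move=> rf rg.
have := @recursive_comp k 1 _ (fun _ => g) rf (fun _ => rg).
by apply: eq_recursive => v; rewrite tnth_mktuple.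
Qed.

Lemma recursive2_comp (k : nat) (f : nat -> nat -> nat)
    (g h : k.-tuple nat -> nat) :
  recursive2 f -> recursive g -> recursive h ->
  recursive (fun v => f (g v) (h v)).
Proof.
move=> rf rg rh; pose u (i : 'I_2) := if val i is 0 then g else h.
have ru i : recursive (u i) by rewrite /u; case: (val i).
have := recursive_comp rf ru.
by apply: eq_recursive => v; rewrite !tnth_mktuple /u /= !inordK.
Qed.

Lemma recursive3_comp (k : nat) (f : nat -> nat -> nat -> nat)
    (g h l : k.-tuple nat -> nat) :
  recursive3 f -> recursive g -> recursive h -> recursive l ->
  recursive (fun v => f (g v) (h v) (l v)).
Proof.
move=> rf rg rh rl.
pose u (i : 'I_3) := match val i with 0 => g | 1 => h | _ => l end.
have ru i : recursive (u i) by rewrite /u; case: (val i) => [|[]].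
have := recursive_comp rf ru.
by apply: eq_recursive => v; rewrite !tnth_mktuple /u /= !inordK.
Qed.

Lemma recursive_S (k : nat) (f : k.-tuple nat -> nat) :
  recursive f -> recursive (fun v => (f v).+1).
Proof. exact: (recursive1_comp recursive_succ). Qed.

Lemma recursive_const (k c : nat) : recursive (fun _ : k.-tuple nat => c).
Proof.
by elim: c => [|c IHc]; [exact: recursive_zero | exact: recursive_S].
Qed.

Lemma recursive1_rec (a : nat) (g : nat -> nat -> nat) (h : nat -> nat) :
  recursive2 g -> h 0 = a -> (forall n, h n.+1 = g n (h n)) -> recursive1 h.
Proof.
move=> rg h0 hS; apply: recursive_prim (recursive_const 0 a) rg _ _ => [v|n v].
  by rewrite -h0; congr h.
by rewrite -[LHS]/(h n.+1) hS; congr g; rewrite (tnth_nth 0) /= inordK.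
Qed.

Lemma recursive2_rec (f : nat -> nat) (g : nat -> nat -> nat -> nat)
    (h : nat -> nat -> nat) :
  recursive1 f -> recursive3 g -> (forall x, h 0 x = f x) ->
  (forall n x, h n.+1 x = g n (h n x) x) -> recursive2 h.
Proof.
move=> rf rg h0 hS; apply: recursive_prim rf rg _ _ => [v|n v].
  by rewrite !(tnth_nth 0) /= !inordK //= h0.
by rewrite !(tnth_nth 0) /= !inordK //= hS.
Qed.

Lemma recursive3_rec (f : nat -> nat -> nat)
    (g : nat -> nat -> nat -> nat -> nat) (h : nat -> nat -> nat -> nat) :
  recursive2 f ->
  recursive (fun v : 4.-tuple nat => g (tnth v (inord 0)) (tnth v (inord 1))
    (tnth v (inord 2)) (tnth v (inord 3))) ->
  (forall x y, h 0 x y = f x y) ->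
  (forall n x y, h n.+1 x y = g n (h n x y) x y) -> recursive3 h.
Proof.
move=> rf rg h0 hS; apply: recursive_prim rf rg _ _ => [v|n v].
  by rewrite !(tnth_nth 0) /= !inordK //= h0.
by rewrite !(tnth_nth 0) /= !inordK //= hS.
Qed.

Lemma recursive2_add : recursive2 addn.
Proof.
apply: (@recursive2_rec id (fun _ r _ => r.+1)) => //.
- exact: recursive_proj.
- by apply: recursive_S; exact: recursive_proj.
Qed.

Lemma recursive_add (k : nat) (f g : k.-tuple nat -> nat) :
  recursive f -> recursive g -> recursive (fun v => f v + g v).
Proof. exact: recursive2_comp recursive2_add. Qed.

Lemma recursive2_mul : recursive2 muln.
Proof.
apply: (@recursive2_rec (fun=> 0) (fun _ r x => x + r)) => //.
- exact: recursive_zero.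
- by apply: recursive_add; exact: recursive_proj.
Qed.

Lemma recursive_mul (k : nat) (f g : k.-tuple nat -> nat) :
  recursive f -> recursive g -> recursive (fun v => f v * g v).
Proof. exact: recursive2_comp recursive2_mul. Qed.

Lemma recursive_exp (k : nat) (f g : k.-tuple nat -> nat) :
  recursive f -> recursive g -> recursive (fun v => f v ^ g v).
Proof.
(* Recursion runs on the first argument, so the exponent is moved to the front. *)
move=> rf rg; apply: (recursive2_comp (f := fun n x => x ^ n)) rg rf.
apply: (@recursive2_rec (fun=> 1) (fun _ r x => x * r)) => //.
- exact: recursive_const.
- by apply: recursive_mul; exact: recursive_proj.
- by move=> n x; rewrite expnS.
Qed.

(** The source of all bounded search below: a bounded existential is a nonzero sum of truth values,
    and a quotient is a count of multiples. An index with two parameters covers every predicate that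
    occurs. *)
Lemma recursive_sum (F : nat -> nat -> nat -> nat) (k : nat)
    (b x y : k.-tuple nat -> nat) :
  recursive3 F -> recursive b -> recursive x -> recursive y ->
  recursive (fun v => \sum_(i < b v) F i (x v) (y v)).
Proof.
move=> rF; apply: (recursive3_comp (f := fun b x y => \sum_(i < b) F i x y)).
apply: (@recursive3_rec (fun _ _ => 0) (fun n r x y => r + F n x y)) => [|| |n].
- exact: recursive_zero.
- apply: recursive_add; first exact: recursive_proj.
  by apply: (recursive3_comp rF); exact: recursive_proj.
- by move=> x0 y0; rewrite big_ord0.
- by move=> x0 y0; rewrite big_ord_recr.
Qed.

Lemma recursive_eq0 (k : nat) (f : k.-tuple nat -> nat) :
  recursive f -> recursive (fun v => f v == 0).
Proof.
apply: (recursive1_comp (f := fun n => (n == 0) : nat)).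
by apply: (@recursive1_rec 1 (fun _ _ => 0)) => //; exact: recursive_zero.
Qed.

Lemma recursive_negb (k : nat) (p : k.-tuple nat -> bool) :
  recursive p -> recursive (fun v => ~~ p v).
Proof. by move=> /recursive_eq0; apply: eq_recursive => v; case: (p v). Qed.

Lemma recursive_andb (k : nat) (p q : k.-tuple nat -> bool) :
  recursive p -> recursive q -> recursive (fun v => p v && q v).
Proof.
by move=> rp rq; apply: eq_recursive (recursive_mul rp rq) => v; rewrite mulnb.
Qed.

Lemma recursive_orb (k : nat) (p q : k.-tuple nat -> bool) :
  recursive p -> recursive q -> recursive (fun v => p v || q v).
Proof.
move=> /recursive_negb rp /recursive_negb rq.
apply: eq_recursive (recursive_negb (recursive_andb rp rq)) => v.
by rewrite negb_and !negbK.
Qed.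

Lemma recursive_implyb (k : nat) (p q : k.-tuple nat -> bool) :
  recursive p -> recursive q -> recursive (fun v => p v ==> q v).
Proof.
move=> /recursive_negb rp rq.
by apply: eq_recursive (recursive_orb rp rq) => v; rewrite implybE.
Qed.

Lemma recursive_leq (k : nat) (f g : k.-tuple nat -> nat) :
  recursive f -> recursive g -> recursive (fun v => f v <= g v).
Proof.
move=> rf rg; apply: recursive_eq0.
apply: (recursive2_comp (f := fun n x => x - n)) rg rf.
apply: (@recursive2_rec id (fun _ r _ => r.-1)) => [|||n x].
- exact: recursive_proj.
- apply: (recursive1_comp (f := predn)); last exact: recursive_proj.
  by apply: (@recursive1_rec 0 (fun n _ => n)) => //; exact: recursive_proj.
- by move=> x; rewrite subn0.
- exact: subnS.
Qed.

Lemma recursive_eqn (k : nat) (f g : k.-tuple nat -> nat) :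
  recursive f -> recursive g -> recursive (fun v => f v == g v).
Proof.
move=> rf rg.
have := recursive_andb (recursive_leq rf rg) (recursive_leq rg rf).
by apply: eq_recursive => v; rewrite eqn_leq.
Qed.

Lemma recursive_has (P : nat -> nat -> nat -> bool) (k : nat)
    (b x y : k.-tuple nat -> nat) :
  recursive3 P -> recursive b -> recursive x -> recursive y ->
  recursive (fun v => has (fun i => P i (x v) (y v)) (iota 0 (b v))).
Proof.
move=> rP rb rx ry.
have := recursive_negb (recursive_eq0 (recursive_sum rP rb rx ry)).
apply: eq_recursive => v; congr (nat_of_bool _).
rewrite -(big_mkord predT (fun i => nat_of_bool (P i (x v) (y v)))).
rewrite /index_iota subn0 sum_nat_seq_eq0 -has_predC.
by apply: eq_has => i /=; rewrite eqb0 negbK.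
Qed.

Lemma recursive_all (P : nat -> nat -> nat -> bool) (k : nat)
    (b x y : k.-tuple nat -> nat) :
  recursive3 P -> recursive b -> recursive x -> recursive y ->
  recursive (fun v => all (fun i => P i (x v) (y v)) (iota 0 (b v))).
Proof.
move=> rP rb rx ry.
have rnP : recursive3 (fun i x y => ~~ P i x y) by exact: recursive_negb.
apply: eq_recursive (recursive_negb (recursive_has rnP rb rx ry)) => v.
by congr (nat_of_bool _); rewrite -all_predC; apply: eq_all => i /=; rewrite negbK.
Qed.

Lemma recursive_odd (k : nat) (f : k.-tuple nat -> nat) :
  recursive f -> recursive (fun v => odd (f v)).
Proof.
apply: (recursive1_comp (f := fun n => odd n : nat)).
apply: (@recursive1_rec 0 (fun _ r => r == 0)) => // [|n].
  by apply: recursive_eq0; exact: recursive_proj.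
by rewrite /=; case: odd.
Qed.

Lemma divn_count (c d : nat) : 0 < d -> c %/ d = \sum_(q < c) (q.+1 * d <= c).
Proof.
move=> d0; under eq_bigr => q _ do rewrite -leq_divRL //.
have : c %/ d <= c by exact: leq_div.
move: (c %/ d) => m; elim: c => [|c IHc] mc; first by rewrite big_ord0; lia.
rewrite big_ord_recr /=; have [cm|cm] := ltnP c m; last by rewrite -IHc // addn0.
rewrite (eq_bigr (fun=> 1)); first by rewrite sum1_card card_ord; lia.
by move=> q _; rewrite (ltn_trans (ltn_ord q) cm).
Qed.

(** * Coding of subsets by binary digits *)

Definition bit (c i : nat) : bool := odd (c %/ 2 ^ i).

Lemma recursive_bit (k : nat) (f g : k.-tuple nat -> nat) :
  recursive f -> recursive g -> recursive (fun v => bit (f v) (g v)).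
Proof.
move=> rf rg; apply: recursive_odd.
have rF : recursive3 (fun q c i => q.+1 * 2 ^ i <= c).
  apply: recursive_leq; last exact: recursive_proj.
  apply: recursive_mul; first by apply: recursive_S; exact: recursive_proj.
  by apply: recursive_exp; [exact: recursive_const | exact: recursive_proj].
apply: eq_recursive (recursive_sum rF rf rf rg) => v.
by rewrite divn_count // expn_gt0.
Qed.

Lemma recursive_dvdn (k : nat) (f g : k.-tuple nat -> nat) :
  recursive f -> recursive g -> recursive (fun v => f v %| g v).
Proof.
move=> rf rg.
have rP : recursive3 (fun q a b => b == q * a).
  apply: recursive_eqn; first exact: recursive_proj.
  by apply: recursive_mul; exact: recursive_proj.
apply: eq_recursive (recursive_has rP (recursive_S rg) rf rg) => v.
congr (nat_of_bool _); apply/hasP/dvdnP => [[q _ /eqP->]|[q gE]]; first by exists q.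
(* The search for the cofactor stops at [g v]. This bounds it when [f v] is positive; when [f v] is
   0, so is [g v], and the cofactor 0 will do. *)
have [f0|f0] := posnP (f v); last first.
  by exists q; [rewrite mem_iota /= add0n ltnS gE leq_pmulr | exact/eqP].
by exists 0; rewrite ?mem_iota //= gE f0 muln0.
Qed.

Lemma recursive_dvd_adj (k : nat) (f g : k.-tuple nat -> nat) :
  recursive f -> recursive g -> recursive (fun v => dvd_adj (f v) (g v)).
Proof.
move=> rf rg; apply: recursive_andb.
  by apply: recursive_negb; exact: recursive_eqn.
by apply: recursive_orb; exact: recursive_dvdn.
Qed.

(* The subset of [{0, ..., n}] coded by [c < 2 ^ n.+1] consists of the positions
   of the binary digits 1 of [c]. *)
Definition code_mis (n c : nat) : bool :=
  all (fun a => bit c a ==> (0 < a) &&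
    all (fun b => bit c b ==> ~~ dvd_adj a b) (iota 0 n.+1)) (iota 0 n.+1) &&
  all (fun k => (0 < k) ==> bit c k ||
    has (fun b => bit c b && dvd_adj k b) (iota 0 n.+1)) (iota 0 n.+1).

Lemma recursive3_code_mis : recursive3 (fun c n _ => code_mis n c).
Proof.
have rp k i : recursive (fun v : k.-tuple nat => tnth v i) by exact: recursive_proj.
apply: recursive_andb.
- apply: (recursive_all (P := fun a c n => bit c a ==> (0 < a) &&
      all (fun b => bit c b ==> ~~ dvd_adj a b) (iota 0 n.+1))) => //; last first.
    exact: recursive_S.
  apply: recursive_implyb; first exact: recursive_bit.
  apply: recursive_andb; first by apply: recursive_leq => //; exact: recursive_const.
  apply: (recursive_all (P := fun b c a => bit c b ==> ~~ dvd_adj a b)) => //.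
    apply: recursive_implyb; first exact: recursive_bit.
    by apply: recursive_negb; exact: recursive_dvd_adj.
  exact: recursive_S.
- apply: (recursive_all (P := fun k c n => (0 < k) ==> bit c k ||
      has (fun b => bit c b && dvd_adj k b) (iota 0 n.+1))) => //; last first.
    exact: recursive_S.
  apply: recursive_implyb; first by apply: recursive_leq => //; exact: recursive_const.
  apply: recursive_orb; first exact: recursive_bit.
  apply: (recursive_has (P := fun b c k => bit c b && dvd_adj k b)) => //.
    by apply: recursive_andb; [exact: recursive_bit | exact: recursive_dvd_adj].
  exact: recursive_S.
Qed.

Definition decode (n c : nat) : {set 'I_n.+1} := [set i : 'I_n.+1 | bit c i].

Lemma bit_inj (n c d : nat) : c < 2 ^ n -> d < 2 ^ n ->
  (forall i, i < n -> bit c i = bit d i) -> c = d.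
Proof.
elim: n c d => [|n IHn] c d; first by rewrite expn0 !ltnS !leqn0 => /eqP-> /eqP->.
rewrite expnS => hc hd cd.
have h0 : odd c = odd d by have := cd 0 isT; rewrite /bit expn0 !divn1.
have : c %/ 2 = d %/ 2.
  apply: IHn => [||i lin]; rewrite ?ltn_divLR // 1?mulnC //.
  by have := cd i.+1 lin; rewrite /bit expnS !divnMA.
by rewrite !divn2 => h; rewrite -(odd_double_half c) -(odd_double_half d) h0 h.
Qed.

Lemma decode_bij (n : nat) :
  bijective (fun c : 'I_(2 ^ n.+1) => decode n c).
Proof.
apply: inj_card_bij => [c d cd|].
  apply/val_inj/(bit_inj (ltn_ord c) (ltn_ord d)) => i lin.
  by have /setP/(_ (Ordinal lin)) := cd; rewrite !inE.
by rewrite -cardsT -powersetT card_powerset cardsT !card_ord.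
Qed.

Lemma code_misE (n c : nat) :
  code_mis n c = mis_set (dvd_graph n) (pos_upto n) (decode n c).
Proof.
have mi (a : 'I_n.+1) : (a : nat) \in iota 0 n.+1 by rewrite mem_iota /=.
have im a : a \in iota 0 n.+1 -> exists i : 'I_n.+1, a = i.
  by rewrite mem_iota /= => la; exists (Ordinal la).
apply/andP/mis_setP => [[/allP h1 /allP h2]|[sub ind mx]]; split.
- by move=> a; rewrite !inE => ca; have /implyP/(_ ca)/andP[] := h1 a (mi a).
- move=> a b; rewrite !inE => ca cb.
  by have /implyP/(_ ca)/andP[_ /allP/(_ b (mi b))/implyP/(_ cb)] := h1 a (mi a).
- move=> k; rewrite !inE => k0 ck.
  have /implyP/(_ k0) := h2 k (mi k); rewrite (negPf ck) orFb.
  by move=> /hasP[_ /im[b ->] /andP[cb kb]]; exists b; rewrite ?inE.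
- apply/allP => _ /im[a ->]; apply/implyP => ca.
  have aS : a \in decode n c by rewrite inE.
  have := sub a aS; rewrite inE => ->; rewrite andTb.
  apply/allP => _ /im[b ->]; apply/implyP => cb.
  by apply: ind => //; rewrite inE.
- apply/allP => _ /im[k ->]; apply/implyP => k0.
  case: (boolP (bit c k)) => // ck; rewrite orFb.
  have [||b + kb] := mx k; rewrite ?inE // => cb.
  by apply/hasP; exists (b : nat) => //; rewrite cb.
Qed.

(** Codes below [2 ^ n.+1] correspond bijectively to subsets, so the count is a bounded sum of the
    truth values of a recursive test. *)
Lemma recursive_num_maximal_primitive (k : nat) (f : k.-tuple nat -> nat) :
  recursive f -> recursive (fun v => num_maximal_primitive (f v)).
Proof.
move=> rf.
have r2 : recursive (fun v => 2 ^ (f v).+1).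
  by apply: recursive_exp (recursive_S rf); exact: recursive_const.
apply: eq_recursive (recursive_sum recursive3_code_mis r2 rf rf) => v.
set n := f v; rewrite num_maximal_primitiveE /mis -sum1dep_card.
rewrite (reindex _ (onW_bij _ (decode_bij n))) /= [RHS]big_mkcond /=.
by apply: eq_bigr => c _; rewrite code_misE; case: mis_set.
Qed.

From mathcomp Require Import all_classical all_reals all_analysis.

Import Order.TTheory GRing.Theory Num.Theory.
Import numFieldNormedType.Exports.

(** * Smooth and rough numbers *)

(** This lemma and the next three allow induction on [y] itself instead of on the list of primes: a
    step to a composite changes nothing, a step to a prime separates its multiples. *)
Lemma upto_nprime (y s : nat) : ~~ prime y.+1 ->
  (upto y.+1).-nat s = (upto y).-nat s.
Proof.
move=> npr; apply: eq_in_pnat => p; rewrite mem_primes => /andP[pp _].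
rewrite !inE /= leq_eqVlt ltnS orb_idl // => /eqP pE.
by rewrite pE (negPf npr) in pp.
Qed.

Lemma uptoC_nprime (y s : nat) : ~~ prime y.+1 ->
  (upto y.+1)^'.-nat s = (upto y)^'.-nat s.
Proof.
move=> npr; apply: eq_in_pnat => p; rewrite mem_primes => /andP[pp _].
rewrite !inE /= leq_eqVlt ltnS orb_idl // => /eqP pE.
by rewrite pE (negPf npr) in pp.
Qed.

Lemma upto_prime (y s : nat) : prime y.+1 ->
  (upto y).-nat s = (upto y.+1).-nat s && ~~ (y.+1 %| s).
Proof.
move=> pr; have [->|s0] := posnP s; first by rewrite andbF.
apply/idP/andP => [ys|[ys nd]].
  split.
    by apply: sub_in_pnat ys => p _; rewrite !inE /= => /leqW.
  apply/negP => d; have := pnat_dvd d ys.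
  by rewrite pnatE // inE /= ltnn.
apply/pnatP => // p pp ps.
have : p \in upto y.+1 by apply: (pnatPpi ys); rewrite mem_primes pp s0.
rewrite !inE /= leq_eqVlt ltnS => /orP[/eqP pE|//].
by rewrite pE (negPf nd) in ps.
Qed.

Lemma uptoC_prime (y s : nat) : prime y.+1 ->
  (upto y.+1)^'.-nat s = (upto y)^'.-nat s && ~~ (y.+1 %| s).
Proof.
move=> pr; have [->|s0] := posnP s; first by rewrite andbF.
apply/idP/andP => [ys|[ys nd]].
  split.
    by apply: sub_in_pnat ys => p _; rewrite !inE /=; apply: contra => /leqW.
  apply/negP => d; have := pnat_dvd d ys.
  by rewrite pnatE // !inE /= leqnn.
apply/pnatP => // p pp ps.
have : p \in (upto y)^' by apply: (pnatPpi ys); rewrite mem_primes pp s0.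
rewrite !inE /= -!ltnNge leq_eqVlt => /orP[/eqP pE|//].
by rewrite pE ps in nd.
Qed.

Lemma upto0 (s : nat) : (upto 0).-nat s = (s == 1).
Proof.
apply/idP/eqP => [h|->//].
have [s1|s1] := leqP s 1; first by have := pnat_gt0 h; lia.
have : pdiv s \in upto 0 by apply: (pnatPpi h); rewrite pi_pdiv.
by rewrite inE /= leqNgt pdiv_gt0.
Qed.

Lemma uptoC0 (s : nat) : (upto 0)^'.-nat s = (0 < s).
Proof.
apply/idP/idP => [/pnat_gt0//|s0]; apply/pnatP => // p pp _.
by rewrite !inE /= -ltnNge prime_gt0.
Qed.

Local Open Scope ring_scope.

Lemma big_nat_dvd (V : nmodType) (P : pred nat) (F : nat -> V) (q n : nat) :
  (0 < q)%N ->
  \sum_(1 <= s < n.+1 | P s && (q %| s)%N) F s =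
  \sum_(1 <= s < (n %/ q).+1 | P (q * s)%N) F (q * s)%N.
Proof.
move=> q0; rewrite -[RHS](big_map (muln q) P F) -[LHS]big_filter -[RHS]big_filter.
apply: perm_big; apply: uniq_perm.
- by rewrite filter_uniq // iota_uniq.
- by rewrite filter_uniq // map_inj_uniq ?iota_uniq // => a b /eqP; rewrite eqn_pmul2l // => /eqP.
move=> s; rewrite !mem_filter mem_index_iota -andbA; congr (_ && _).
apply/idP/mapP => [/and3P[/dvdnP[t ->] ts sn]|[t + ->]].
  exists t; last by rewrite mulnC.
  rewrite mem_index_iota ltnS leq_divRL // -[(t * q <= n)%N]ltnS sn andbT.
  by case: t ts {sn}.
rewrite mem_index_iota ltnS leq_divRL // mulnC => /andP[t0 tn].
by rewrite dvdn_mulr // muln_gt0 t0 q0 ltnS.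
Qed.

(** At exponent 1 the inverse of this product is the density of the integers free of primes up to
    [y]. *)
Definition euler (R : realType) (y : nat) (t : R) : R :=
  \prod_(0 <= p < y.+1 | prime p) (1 - p%:R `^ (- t))^-1.

Lemma euler0 (R : realType) (t : R) : euler 0 t = 1.
Proof. by rewrite /euler big_mkcond big_nat1. Qed.

Lemma eulerS (R : realType) (y : nat) (t : R) :
  euler y.+1 t =
  euler y t * (if prime y.+1 then (1 - y.+1%:R `^ (- t))^-1 else 1).
Proof. by rewrite /euler big_mkcond big_nat_recr //= -big_mkcond. Qed.

Lemma powRN_lt1 (R : realType) (p : nat) (t : R) :
  (1 < p)%N -> 0 < t -> p%:R `^ (- t) < 1.
Proof.
move=> p1 t0; rewrite /powR pnatr_eq0 gtn_eqF 1?ltnW // expR_lt1.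
by rewrite mulNr oppr_lt0 mulr_gt0 // ln_gt0 // ltr1n.
Qed.

Lemma euler_ge1 (R : realType) (y : nat) (t : R) : 0 < t -> 1 <= euler y t.
Proof.
move=> t0; elim: y => [|y IHy]; first by rewrite euler0.
rewrite eulerS; case: ifPn => pr; last by rewrite mulr1.
have := powRN_lt1 (prime_gt1 pr) t0 => lt1.
by rewrite -[leLHS]mulr1 ler_pM // invf_ge1 ?subr_gt0 // gerBl powR_ge0.
Qed.

Lemma powR_natM (R : realType) (a b : nat) (t : R) :
  (a * b)%:R `^ t = a%:R `^ t * b%:R `^ t.
Proof. by rewrite natrM powRM. Qed.

(** When q = y + 1 is prime, the terms not divisible by q are at most the product for [y] by
    induction, and those divisible by q are at most q ^ -t times the whole sum. Solving this
    inequality for the sum produces the factor 1 / (1 - q ^ -t) without any infinite series. *)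
Lemma sum_smooth_le (R : realType) (y n : nat) (t : R) : 0 < t ->
  \sum_(1 <= i < n.+1 | (upto y).-nat i) i%:R `^ (- t) <= euler y t.
Proof.
move=> t0; elim: y n => [|y IHy] n.
  rewrite euler0; case: n => [|n]; first by rewrite big_geq.
  rewrite big_mkcond big_nat_recl //= powR1 -[leRHS]addr0 lerD2l.
  rewrite big_nat big1 // => i /andP[i0 _]; rewrite upto0.
  by case: i i0.
rewrite eulerS; case: ifPn => pr; last first.
  by under eq_bigl do rewrite upto_nprime //; rewrite mulr1.
set q := y.+1; have := powRN_lt1 (prime_gt1 pr) t0 => lt1.
have sub0 : 0 < 1 - q%:R `^ (- t) by rewrite subr_gt0.
rewrite ler_pdivlMr // mulrBr mulr1 lerBlDr.
rewrite [leLHS](bigID (fun s => (q %| s)%N)) /= [leLHS]addrC.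
apply: lerD.
  by under eq_bigl do rewrite -upto_prime //; exact: IHy.
rewrite big_nat_dvd //=.
under eq_bigl do rewrite pnatM pnatE // inE /= leqnn /=.
under eq_bigr do rewrite powR_natM.
rewrite -mulr_sumr mulrC ler_wpM2r ?powR_ge0 //.
rewrite [leRHS]big_mkcond [leLHS]big_mkcond /=.
rewrite [leRHS](big_cat_nat _ (n := (n %/ q).+1)) //=; last first.
  by rewrite ltnS leq_div.
by rewrite lerDl sumr_ge0 // => i _; case: ifP => // _; exact: powR_ge0.
Qed.

(** * Counting rough numbers *)

Definition rough_count (R : realType) (y q : nat) : R :=
  \sum_(1 <= r < q.+1 | (upto y)^'.-nat r) 1.

(** Legendre's recursion. The numbers lost in the step are the multiples of the prime [y.+1]; since
    that prime exceeds [y], their cofactors range over all numbers rough for [y]. *)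
Lemma rough_countS (R : realType) (y q : nat) : prime y.+1 ->
  rough_count R y.+1 q = rough_count R y q - rough_count R y (q %/ y.+1).
Proof.
move=> pr; rewrite /rough_count.
rewrite [X in _ = X - _](bigID (fun s => (y.+1 %| s)%N)) /=.
rewrite big_nat_dvd //=.
rewrite (eq_bigl _ _ (fun s => esym (uptoC_prime s pr))).
rewrite [X in _ = X + _ - _](eq_bigl (fun r => (upto y)^'.-nat r)).
  by rewrite addrAC subrr add0r.
by move=> s /=; rewrite pnatM pnatE // !inE /= ltnn.
Qed.

(* Legendre's sieve with Rankin's trick: each term of the inclusion-exclusion is
   off by at most [min 1 (n / (i d)) <= (n / (i d)) `^ t]. *)
Lemma rough_count_approx (R : realType) (y n i : nat) (t : R) :
  (0 < i)%N -> 0 < t -> t <= 1 ->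
  `|rough_count R y (n %/ i) - n%:R / i%:R * (euler y (1 : R))^-1| <=
  (n%:R / i%:R) `^ t * euler y t.
Proof.
(* The induction keeps [i] general because Legendre's recursion refers to [i * q]. *)
move=> i0 t0 t1; elim: y i i0 => [|y IHy] i i0.
  rewrite !euler0 invr1 !mulr1 /rough_count.
  have -> : \sum_(1 <= r < (n %/ i).+1 | (upto 0)^'.-nat r) 1 = (n %/ i)%:R :> R.
    under eq_bigl do rewrite uptoC0.
    rewrite big_nat_cond (eq_bigl (fun r => (1 <= r < (n %/ i).+1)%N)); last first.
      by move=> r; rewrite andbC; case: (0 < r)%N.
    by rewrite -big_nat sumr_const_nat subn1.
  have i0' : 0 < i%:R :> R by rewrite ltr0n.
  have nE : n%:R = (n %/ i)%:R * i%:R + (n %% i)%:R :> R.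
    by rewrite -natrM -natrD -divn_eq.
  (* With x = n / i, the distance from x to its integer part is x itself if x < 1, and then x <= x ^
     t; otherwise it is less than 1 <= x ^ t. *)
  have [ni|ni] := ltnP n i.
    rewrite divn_small // sub0r normrN.
    have x0 : 0 <= n%:R / i%:R :> R by rewrite divr_ge0.
    rewrite ger0_norm //; move: x0; rewrite le_eqVlt => /orP[/eqP<-|x0].
      exact: powR_ge0.
    have x1 : 0 < (n%:R / i%:R : R) <= 1.
      by rewrite x0 ler_pdivrMr // mul1r ler_nat ltnW.
    by have := ger_powR x1 t1; rewrite powRr1 // ltW.
  have -> : (n %/ i)%:R - n%:R / i%:R = - ((n %% i)%:R / i%:R) :> R.
    by rewrite nE; field; rewrite lt0r_neq0.
  rewrite normrN ger0_norm ?divr_ge0 //.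
  apply: (@le_trans _ _ 1).
    by rewrite ler_pdivrMr // mul1r ler_nat ltnW // ltn_mod.
  apply: (@le_trans _ _ (1 `^ t)); first by rewrite powR1.
  apply: (ge0_ler_powR (ltW t0)); rewrite ?nnegrE ?divr_ge0 //.
  by rewrite ler_pdivlMr // mul1r ler_nat.
rewrite !eulerS; case: ifPn => pr; last first.
  rewrite !mulr1; have <- : rough_count R y (n %/ i) = rough_count R y.+1 (n %/ i).
    by apply: eq_bigl => s; rewrite uptoC_nprime.
  exact: IHy.
set q := y.+1; have := powRN_lt1 (prime_gt1 pr) t0 => lt1.
have sub0 : 0 < 1 - q%:R `^ (- t) by rewrite subr_gt0.
rewrite rough_countS // -divnMA -/q powR_inv1 //.
have q0 : q%:R != 0 :> R by rewrite pnatr_eq0.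
have i0' : i%:R != 0 :> R by rewrite pnatr_eq0 -lt0n.
have := IHy _ i0; have := IHy (i * q)%N; rewrite muln_gt0 i0 => /(_ isT).
set A := rough_count _ _ _; set B := rough_count _ _ _.
have -> : n%:R / (i * q)%:R = n%:R / i%:R * q%:R^-1 :> R.
  by rewrite natrM invfM mulrA.
rewrite powRM ?divr_ge0 ?invr_ge0 //.
have -> : q%:R^-1 `^ t = q%:R `^ (- t) :> R.
  by rewrite -powR_inv1 // -powRrM mulN1r.
set E1 := (euler y 1)^-1; set x := n%:R / i%:R => hA hB.
have -> : B - A - x * ((euler y 1) * (1 - q%:R^-1)^-1)^-1 =
          (B - x * E1) - (A - x * q%:R^-1 * E1).
  by rewrite invfM invrK -/E1; ring.
apply: le_trans (ler_normB _ _) _; apply: le_trans (lerD hB hA) _.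
have -> : x `^ t * euler y t + x `^ t * q%:R `^ (- t) * euler y t =
          x `^ t * euler y t * (1 + q%:R `^ (- t)) by ring.
rewrite mulrA ler_wpM2l //.
  by rewrite mulr_ge0 ?powR_ge0 // (le_trans ler01 (euler_ge1 _ t0)).
rewrite -[leRHS]mul1r ler_pdivlMr //.
(* The errors at [i] and [i * q] add up to a factor 1 + z, which the new Euler factor 1 / (1 - z)
   absorbs. *)
set z := q%:R `^ (- t); have -> : (1 + z) * (1 - z) = 1 - z ^+ 2 by ring.
by rewrite gerBl sqr_ge0.
Qed.

(** * Comparison of growth rates *)

Definition smooth_gain (R : realType) (y i : nat) : R :=
  ln (mis_smooth y i)%:R - ln (mis_smooth y i.-1)%:R.

Lemma smooth_gain_ge0 (R : realType) (y i : nat) : 0 <= smooth_gain R y i.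
Proof.
rewrite subr_ge0 ler_ln ?posrE ?ltr0n ?mis_smooth_gt0 // ler_nat.
by case: i => //= i; exact: mis_smooth_leS.
Qed.

Lemma smooth_gain_le (R : realType) (y i : nat) : (0 < i)%N ->
  smooth_gain R y i <= if (upto y).-nat i then ln 2 else 0.
Proof.
case: i => // i _; rewrite /smooth_gain /=; case: ifPn => si; last first.
  by rewrite mis_smoothS_id // subrr.
have m0 : 0 < (mis_smooth y i)%:R :> R by rewrite ltr0n mis_smooth_gt0.
rewrite lerBlDr -lnM ?posrE // ler_ln ?posrE ?ltr0n ?mis_smooth_gt0 ?mulr_gt0 //.
by rewrite -natrM ler_nat mis_smoothS_le.
Qed.

Lemma ln_prod_nat (R : realType) (I : Type) (s : seq I) (P : pred I)
    (F : I -> nat) : (forall i, 0 < F i)%N ->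
  ln ((\prod_(i <- s | P i) F i)%N%:R : R) = \sum_(i <- s | P i) ln (F i)%:R.
Proof.
move=> F0; elim: s => [|i s IHs]; first by rewrite !big_nil ln1.
rewrite !big_cons; case: ifP => // _.
by rewrite natrM lnM ?posrE ?ltr0n ?prodn_gt0 // IHs.
Qed.

Lemma num_maximal_primitive_gt0 (n : nat) : (0 < num_maximal_primitive n)%N.
Proof. by apply: leq_trans (num_maximal_primitive_ge n); rewrite expn_gt0. Qed.

Lemma ln_num_rough (R : realType) (y n : nat) : (0 < y)%N ->
  `|ln (num_maximal_primitive n)%:R -
    \sum_(1 <= r < n.+1 | (upto y)^'.-nat r) ln (mis_smooth y (n %/ r))%:R|
  <= n%:R / y%:R * ln 2 :> R.
Proof.
move=> y0; have [] := num_maximal_primitive_rough n y0.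
rewrite -ln_prod_nat; last by move=> r; exact: mis_smooth_gt0.
set P := (\prod_(_ <= _ < _ | _) _)%N.
have P0 : (0 < P)%N by rewrite prodn_gt0 // => r; exact: mis_smooth_gt0.
have m0 := num_maximal_primitive_gt0 n.
have le_ln (a b : nat) : (0 < a)%N -> (0 < b)%N ->
    (a <= 2 ^ (n %/ y) * b)%N -> ln a%:R - ln b%:R <= n%:R / y%:R * ln 2 :> R.
  move=> a0 b0 ab; apply: (@le_trans _ _ ((n %/ y)%:R * ln 2)); last first.
    rewrite ler_wpM2r ?ln_ge0 ?ler1n // ler_pdivlMr ?ltr0n // -natrM ler_nat.
    exact: leq_trunc_div.
  rewrite lerBlDr mulr_natl -lnXn // -natrX -lnM ?posrE ?ltr0n ?expn_gt0 //.
  by rewrite -natrM ler_ln ?posrE ?ltr0n ?muln_gt0 ?expn_gt0 // ler_nat.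
move=> /(le_ln _ _ m0 P0) h1 /(le_ln _ _ P0 m0) h2.
by rewrite ler_norml h1 andbT lerNl opprB.
Qed.

(** Summation by parts: each logarithm telescopes into gains, and the double sum over the pairs with
    [i * r <= n] is taken in the other order. *)
Lemma sum_rough_gain (R : realType) (y n : nat) :
  \sum_(1 <= r < n.+1 | (upto y)^'.-nat r) ln (mis_smooth y (n %/ r))%:R =
  \sum_(1 <= i < n.+1) smooth_gain R y i * rough_count R y (n %/ i).
Proof.
have lnE q : ln (mis_smooth y q)%:R = \sum_(1 <= i < q.+1) smooth_gain R y i.
  rewrite big_add1 /= (telescope_sumr (fun i => ln (mis_smooth y i)%:R)) //.
  by rewrite mis_smooth0 ln1 subr0.
transitivity (\sum_(1 <= r < n.+1 | (upto y)^'.-nat r)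
    \sum_(1 <= i < n.+1 | (i * r <= n)%N) smooth_gain R y i).
  rewrite big_nat_cond [RHS]big_nat_cond; apply: eq_bigr => r.
  move=> /andP[/andP[r0 _] _]; rewrite lnE (@big_nat_widen _ _ _ _ _ n.+1) /=.
    by apply: eq_bigl => i; rewrite ltnS leq_divRL.
  by rewrite ltnS leq_div.
rewrite (exchange_big_dep_nat predT) //= big_nat [RHS]big_nat.
apply: eq_bigr => i /andP[i0 _]; rewrite /rough_count mulr_sumr.
rewrite [RHS](@big_nat_widen _ _ _ _ _ n.+1) ?ltnS ?leq_div //=.
under [RHS]eq_bigr do rewrite mulr1.
by apply: eq_bigl => r; rewrite ltnS leq_divRL // mulnC.
Qed.

(** What ln m(n) / n becomes when each rough count is replaced by the density times n / i. *)
Definition smooth_rate (R : realType) (y n : nat) : R :=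
  (euler y 1)^-1 * \sum_(1 <= i < n.+1) smooth_gain R y i / i%:R.

(** One factor [euler y t] is the sieve error for a single [i]; the other comes from summing i ^ -t
    over the smooth [i], the only ones with a nonzero gain. *)
Lemma ln_num_smooth_rate (R : realType) (y n : nat) (t : R) :
  (0 < y)%N -> 0 < t -> t <= 1 ->
  `|ln (num_maximal_primitive n)%:R - n%:R * smooth_rate R y n| <=
  ln 2 * (n%:R / y%:R + n%:R `^ t * euler y t ^+ 2).
Proof.
move=> y0 t0 t1; have l20 : 0 <= ln (2 : R) by rewrite ln_ge0 ?ler1n.
have E0 : 0 <= euler y t by apply: le_trans (euler_ge1 _ t0).
rewrite -[X in X - _](subrK (\sum_(1 <= r < n.+1 | (upto y)^'.-nat r)
    ln (mis_smooth y (n %/ r))%:R)) -addrA mulrDr.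
apply: le_trans (ler_normD _ _) (lerD _ _).
  by rewrite mulrC; exact: ln_num_rough.
rewrite sum_rough_gain /smooth_rate [n%:R * (_ * _)]mulrA [_ * \sum_(_ <= _ < _) _]mulr_sumr -sumrB.
apply: le_trans (ler_norm_sum _ _ _) _.
apply: (@le_trans _ _ (\sum_(1 <= i < n.+1 | (upto y).-nat i)
    (ln 2 * (n%:R `^ t * euler y t)) * i%:R `^ (- t))); last first.
  rewrite -mulr_sumr expr2 !mulrA ler_wpM2l ?sum_smooth_le //.
  by rewrite !mulr_ge0 ?powR_ge0.
rewrite big_nat [leRHS]big_mkcond [leRHS]big_nat.
apply: ler_sum => i /andP[i0 _].
have -> : smooth_gain R y i * rough_count R y (n %/ i) -
    n%:R / euler y 1 * (smooth_gain R y i / i%:R) = smooth_gain R y i *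
    (rough_count R y (n %/ i) - n%:R / i%:R * (euler y 1)^-1) by ring.
rewrite normrM ger0_norm ?smooth_gain_ge0 //.
have := ler_pM (smooth_gain_ge0 R y i) (normr_ge0 _) (smooth_gain_le R y i0)
  (rough_count_approx y n i0 t0 t1).
move/le_trans; apply; case: ifP => _; last by rewrite mul0r.
rewrite powRM ?invr_ge0 // -powR_inv1 // -powRrM mulN1r le_eqVlt.
by apply/orP; left; apply/eqP; ring.
Qed.

(** Rankin's trick again: for i > n and t <= 1 one has 1 / i <= n ^ (t - 1) i ^ -t, and the smooth
    sum of i ^ -t is at most the Euler product. *)
Lemma smooth_rate_tail (R : realType) (y n N : nat) (t : R) :
  (0 < n)%N -> (n <= N)%N -> 0 < t -> t <= 1 ->
  `|smooth_rate R y N - smooth_rate R y n| <=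
  ln 2 * (n%:R `^ (t - 1) * euler y t).
Proof.
move=> n0 nN t0 t1; have l20 : 0 <= ln (2 : R) by rewrite ln_ge0 ?ler1n.
have E1 : 1 <= euler y (1 : R) by apply: euler_ge1.
rewrite /smooth_rate -mulrBr (big_cat_nat _ (n := n.+1)) //=.
rewrite addrAC subrr add0r; set S := \sum_(_ <= _ < _) _.
have S0 : 0 <= S.
  by rewrite sumr_ge0 // => i _; rewrite divr_ge0 ?smooth_gain_ge0.
rewrite ger0_norm ?mulr_ge0 ?invr_ge0 ?(le_trans ler01 E1) //.
apply: (@le_trans _ _ S).
  by rewrite -[leRHS]mul1r ler_wpM2r // invf_le1 // (lt_le_trans ltr01 E1).
have step i : (n.+1 <= i)%N -> smooth_gain R y i / i%:R <=
    if (upto y).-nat i then ln 2 * n%:R `^ (t - 1) * i%:R `^ (- t) else 0.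
  move=> ni; have i0 : (0 < i)%N by exact: leq_trans ni.
  have := smooth_gain_le R y i0; case: ifP => _ h; last first.
    by rewrite -[leRHS](mul0r i%:R^-1) ler_wpM2r ?invr_ge0.
  rewrite -mulrA; apply: ler_pM => //; rewrite ?smooth_gain_ge0 ?invr_ge0 //.
  have -> : i%:R^-1 = i%:R `^ (t - 1) * i%:R `^ (- t) :> R.
    rewrite -powRD; last by rewrite pnatr_eq0 -lt0n i0 implybT.
    by rewrite addrAC subrr add0r powR_inv1.
  rewrite ler_wpM2r ?powR_ge0 //.
  rewrite -[t - 1]opprB !powRN lef_pV2 ?posrE ?powR_gt0 ?ltr0n //.
  by rewrite ge0_ler_powR ?nnegrE ?subr_ge0 // ler_nat ltnW.
apply: (@le_trans _ _ (\sum_(n.+1 <= i < N.+1 | (upto y).-nat i)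
    ln 2 * n%:R `^ (t - 1) * i%:R `^ (- t))).
  rewrite /S big_nat [leRHS]big_mkcond [leRHS]big_nat.
  by apply: ler_sum => i /andP[ni _]; exact: step.
rewrite -mulr_sumr mulrA ler_wpM2l ?mulr_ge0 ?powR_ge0 //.
apply: le_trans (sum_smooth_le y N t0).
rewrite [leLHS]big_mkcond [leRHS]big_mkcond [leRHS](big_cat_nat _ (n := n.+1)) //=.
by rewrite lerDr sumr_ge0 // => i _; case: ifP => // _; exact: powR_ge0.
Qed.

Definition growth_rate (R : realType) (n : nat) : R :=
  ln (num_maximal_primitive n)%:R / n%:R.

(** The same [y] is used at [n] and at [N]. The two approximations give 2 / y and two of the three
    Rankin terms, the tail between [n] and [N] gives the third; all are bounded by their value at
    [n] since t - 1 <= 0. *)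
Lemma growth_rate_sub (R : realType) (y n N : nat) (t : R) :
  (0 < y)%N -> (0 < n)%N -> (n <= N)%N -> 0 < t -> t <= 1 ->
  `|growth_rate R n - growth_rate R N| <=
  ln 2 * (2 / y%:R + 3 * (n%:R `^ (t - 1) * euler y t ^+ 2)).
Proof.
move=> y0 n0 nN t0 t1; have l20 : 0 <= ln (2 : R) by rewrite ln_ge0 ?ler1n.
have N0 : (0 < N)%N by exact: leq_trans nN.
have E1 := euler_ge1 y t0; have E0 : 0 <= euler y t by apply: le_trans E1.
have near_rate m : (0 < m)%N -> `|growth_rate R m - smooth_rate R y m| <=
    ln 2 * (y%:R^-1 + m%:R `^ (t - 1) * euler y t ^+ 2).
  move=> m0; have m0' : m%:R != 0 :> R by rewrite pnatr_eq0 -lt0n.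
  have mp : 0 < m%:R :> R by rewrite ltr0n.
  rewrite -(ler_pM2l mp) -{1}(gtr0_norm mp) -normrM.
  have -> : m%:R * (growth_rate R m - smooth_rate R y m) =
      ln (num_maximal_primitive m)%:R - m%:R * smooth_rate R y m.
    by rewrite /growth_rate; field.
  apply: le_trans (ln_num_smooth_rate m y0 t0 t1) _; rewrite le_eqVlt.
  apply/orP; left; apply/eqP.
  have -> : m%:R `^ t = m%:R * m%:R `^ (t - 1) :> R.
    rewrite -[X in X * _]powRr1 // -powRD ?m0' ?implybT //.
    by rewrite addrC subrK.
  by ring.
have := near_rate n n0; have := near_rate N N0.
have := smooth_rate_tail y n0 nN t0 t1.
have hN : N%:R `^ (t - 1) <= n%:R `^ (t - 1) :> R.
  rewrite -[t - 1]opprB !powRN lef_pV2 ?posrE ?powR_gt0 ?ltr0n //.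
  by rewrite ge0_ler_powR ?nnegrE ?subr_ge0 // ler_nat.
have hE : euler y t <= euler y t ^+ 2 by rewrite expr2 ler_peMl.
have h1 : ln 2 * (n%:R `^ (t - 1) * euler y t) <=
    ln 2 * (n%:R `^ (t - 1) * euler y t ^+ 2).
  by rewrite ler_wpM2l // ler_wpM2l ?powR_ge0.
have h2 : ln 2 * (N%:R `^ (t - 1) * euler y t ^+ 2) <=
    ln 2 * (n%:R `^ (t - 1) * euler y t ^+ 2).
  by rewrite ler_wpM2l // ler_wpM2r ?sqr_ge0.
rewrite !ler_norml => /andP[a1 a2] /andP[b1 b2] /andP[c1 c2].
apply/andP; split; lra.
Qed.

(** * The rate of convergence *)

Lemma harmonic_le (R : realType) (N : nat) : (0 < N)%N ->
  \sum_(1 <= m < N.+1) m%:R^-1 <= 1 + ln N%:R :> R.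
Proof.
elim: N => // -[_ _|N IHN _]; first by rewrite big_nat1 invr1 ln1 addr0.
rewrite big_nat_recr //=; apply: le_trans (lerD (IHN isT) (lexx _)) _.
rewrite -addrA lerD2l -lerBrDl.
have N0 : 0 < N.+1%:R :> R by rewrite ltr0n.
have NE : N.+2%:R = N.+1%:R + 1 :> R by rewrite -natr1.
rewrite -[leRHS]opprB lerNr -ln_div ?posrE ?ltr0n //.
have -> : N.+1%:R / N.+2%:R = 1 + (- N.+2%:R^-1) :> R.
  by rewrite NE; field; apply: lt0r_neq0; lra.
by apply: le_ln1Dx; rewrite ltrN2 invf_lt1 ?ltr0n // ltr1n.
Qed.

Definition prime_sum (R : realType) (y : nat) (t : R) : R :=
  \sum_(0 <= p < y.+1 | prime p) p%:R `^ (- t).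

Lemma card_prime_pairs (y m : nat) :
  (#|[pred x : 'I_y.+1 * 'I_y.+1 |
      [&& prime x.1, prime x.2 & (x.1 * x.2 == m)%N]]| <= 2)%N.
Proof.
set P := [pred x | _]; case: (pickP P) => [[p q]|P0]; last by rewrite eq_card0.
move=> /and3P[/= pp pq /eqP mE].
apply: (@leq_trans #|[:: (p, q); (q, p)]|); last exact: card_size.
apply/fintype.subset_leq_card/fintype.subsetP => -[a b].
rewrite !inE /= => /and3P[pa pb /eqP abm].
have : (a %| p * q)%N by rewrite mE -abm dvdn_mulr.
rewrite Euclid_dvdM // !dvdn_prime2 // => /orP[] /eqP /val_inj aE; subst a.
- suff -> : b = q by rewrite eqxx.
  by apply/val_inj/eqP; rewrite -(@eqn_pmul2l p) ?prime_gt0 // abm mE.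
- suff -> : b = p by rewrite eqxx orbT.
  by apply/val_inj/eqP; rewrite -(@eqn_pmul2l q) ?prime_gt0 // abm mulnC mE.
Qed.

(* Every [m] is a product of two primes in at most two ways, so the square of the
   sum over primes is bounded by twice a sum over all integers up to [y ^ 2].
   This replaces Chebyshev's estimate. *)
Lemma prime_sum_sqr_le (R : realType) (y : nat) (t : R) :
  (0 < y)%N -> 0 < t -> t <= 1 ->
  prime_sum y t ^+ 2 <= 2 * (y%:R `^ (1 - t)) ^+ 2 * (1 + 2 * ln y%:R).
Proof.
move=> y0 t0 t1; rewrite /prime_sum big_mkord expr2 big_distrlr /= pair_big /=.
pose g (x : 'I_y.+1 * 'I_y.+1) : 'I_(y * y).+1 := inord (x.1 * x.2).
have gE x : g x = (x.1 * x.2)%N :> nat.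
  by rewrite inordK // ltnS leq_mul // -ltnS.
rewrite (partition_big g predT) //=.
apply: (@le_trans _ _ (\sum_(m < (y * y).+1) 2 * m%:R `^ (- t))).
  apply: ler_sum => m _; rewrite (eq_bigr (fun _ => m%:R `^ (- t))); last first.
    by move=> x /andP[_ /eqP <-]; rewrite gE powR_natM.
  rewrite sumr_const -[leLHS]mulr_natl ler_wpM2r ?powR_ge0 // ler_nat.
  apply: leq_trans (card_prime_pairs y m); apply/fintype.subset_leq_card.
  by apply/fintype.subsetP => x; rewrite unfold_in inE -andbA -gE.
rewrite -mulr_sumr -mulrA ler_wpM2l //.
rewrite -(big_mkord predT (fun m => m%:R `^ (- t))) big_ltn //.
(* The term for m = 0 vanishes, since 0 raised to a nonzero exponent is 0 here. *)
rewrite powR0 ?oppr_eq0 ?gt_eqF // add0r.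
apply: (@le_trans _ _ (\sum_(1 <= m < (y * y).+1)
    (y%:R `^ (1 - t)) ^+ 2 * m%:R^-1)).
  rewrite big_nat [leRHS]big_nat; apply: ler_sum => m /andP[m0 my].
  have -> : m%:R `^ (- t) = m%:R `^ (1 - t) * m%:R^-1 :> R.
    rewrite -powR_inv1 // -powRD; first by congr (_ `^ _); ring.
    by rewrite pnatr_eq0 -lt0n m0 implybT.
  rewrite ler_wpM2r ?invr_ge0 // expr2 -powR_natM.
  by rewrite ge0_ler_powR ?nnegrE ?subr_ge0 // ler_nat -ltnS.
rewrite -mulr_sumr ler_wpM2l ?sqr_ge0 //.
apply: le_trans (harmonic_le _ _) _; first by rewrite muln_gt0 y0.
by rewrite natrM lnM ?posrE ?ltr0n // mulr2n mulrDl !mul1r.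
Qed.

(** For 0 <= x <= 3 / 4 one has 1 / (1 - x) <= 1 + 4 x <= exp (4 x), and t >= 1 / 2 makes p ^ -t at
    most 2 ^ (- 1 / 2) < 3 / 4. *)
Lemma euler_le_expR (R : realType) (y : nat) (t : R) : 2^-1 <= t ->
  euler y t <= expR (4 * prime_sum y t).
Proof.
move=> t2; rewrite /euler /prime_sum mulr_sumr expR_sum.
apply: ler_prod => p pp; have p1 := prime_gt1 pp.
have t0 : 0 < t by apply: lt_le_trans t2; rewrite invr_gt0.
have lt1 := powRN_lt1 p1 t0; set x := p%:R `^ (- t) in lt1 *.
have x0 : 0 <= x := powR_ge0 _ _.
rewrite invr_ge0 subr_ge0 (ltW lt1) /=.
have x34 : x <= 3 / 4.
  have : x ^+ 2 <= 2^-1.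
    rewrite /x -powR_mulrn ?powR_ge0 // -powRrM.
    apply: (@le_trans _ _ (2 `^ (-1))); last by rewrite powR_inv1.
    apply: (@le_trans _ _ (p%:R `^ (-1))).
      by apply: ler_powR; [rewrite ler1n prime_gt0 | lra].
    by rewrite !powR_inv1 // lef_pV2 ?posrE ?ltr0n ?(ltnW p1) // ler_nat.
  by move=> h; nra.
have d0 : 0 < 1 - x by lra.
rewrite -[leLHS]mul1r ler_pdivrMr //.
have := expR_ge1Dx (4 * x); nra.
Qed.

(** With b the square root in the claim, y just above exp b and t = 1 - s, the terms are 1 / y <=
    exp (- b) and n ^ -s E ^ 2 <= exp (- 6 b / 5) exp (b / 5). The 5 of the conclusion is 2 + 3 from
    [growth_rate_sub]. *)
Lemma growth_rate_cauchy (R : realType) (n N : nat) :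
  96 * 1000 * expR 2 <= ln (ln n%:R) :> R -> (n <= N)%N ->
  `|growth_rate R n - growth_rate R N| <=
  5 * ln 2 * expR (- Num.sqrt (6^-1 * ln n%:R * ln (ln n%:R))).
Proof.
set L := ln n%:R; set u := ln L => uK nN.
have e2 : 1 <= expR 2 :> R by have := expR_ge1Dx (2 : R); lra.
have u0 : 96 * 1000 <= u by lra.
have L1 : 1 < L.
  by rewrite ltNge; apply/negP => /ln_le0; rewrite -/u; lra.
have L0 : 0 < L by lra.
have n0 : (0 < n)%N.
  by rewrite lt0n; apply: contraTneq L0 => n0; rewrite /L n0 ln0 ?ltxx.
have LE : L = expR u by rewrite lnK ?posrE.
set b := Num.sqrt _.
have b2 : b ^+ 2 = 6^-1 * L * u by rewrite sqr_sqrtr // !mulr_ge0 //; lra.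
have b0 : 0 <= b by rewrite sqrtr_ge0.
have ub : expR (u / 2) <= b.
  rewrite -(ler_pXn2r (ltn0Sn 1)) ?nnegrE ?expR_ge0 // b2.
  rewrite -expRM_natr (_ : u / 2 * 2%:R = u); last by field.
  by rewrite -LE; nra.
have u2b : u / 2 + 1 <= b by have := expR_ge1Dx (u / 2); lra.
have bp : 0 < b by lra.
(* For s = c u / b one gets n ^ -s = exp (- 6 c b), so c > 1 / 6 is needed to leave room for E ^ 2.
   The prime sum is bounded by a multiple of L ^ c sqrt b, which is small against b for c < 1 / 4
   because b >= sqrt L. The choice c = 1 / 5 lies in between. *)
pose s := u / (5 * b).
have s0 : 0 < s by rewrite divr_gt0 //; lra.
have s2 : s <= 2^-1 by rewrite ler_pdivrMr //; lra.
have sb : s * b = u / 5 by rewrite /s; field; exact: lt0r_neq0.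
pose y := (Num.truncn (expR b)).+1.
have yb : expR b <= y%:R by rewrite ltW // truncnS_gt.
have y1 : 1 <= expR b by have := expR_ge1Dx b; lra.
have lny : ln y%:R <= b + 1.
  rewrite -[leRHS]expRK ler_ln ?posrE ?expR_gt0 ?ltr0n // expRD.
  have : (Num.truncn (expR b))%:R <= expR b by rewrite truncn_le expR_ge0.
  have := expR_ge1Dx (1 : R); rewrite /y -natr1; nra.
have lny0 : 0 <= ln y%:R :> R by rewrite ln_ge0 // ler1n.
have t0 : 0 < 1 - s by lra.
have t1 : 1 - s <= 1 by lra.
have := growth_rate_sub (ltn0Sn _ : 0 < y)%N n0 nN t0 t1.
have -> : n%:R `^ (1 - s - 1) = expR (- (6 / 5 * b)).
  rewrite /powR pnatr_eq0 gtn_eqF // -/L; congr expR.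
  have -> : 1 - s - 1 = - s by ring.
  have sbL : s * b * L = 6 / 5 * b ^+ 2 by rewrite sb b2; field.
  by apply: (mulIf (lt0r_neq0 bp)); lra.
have S0 : 0 <= prime_sum y (1 - s).
  by rewrite sumr_ge0 // => p _; exact: powR_ge0.
have S8 : 8 * prime_sum y (1 - s) <= b / 5.
  rewrite -(ler_pXn2r (ltn0Sn 1)) ?nnegrE ?mulr_ge0 ?invr_ge0 // exprMn.
  have := prime_sum_sqr_le (ltn0Sn _ : 0 < y)%N t0 t1.
  have -> : 1 - (1 - s) = s by ring.
  have ys : y%:R `^ s <= expR (u / 5 + 1).
    rewrite /powR pnatr_eq0 /= ler_expR.
    have : s * ln y%:R <= s * (b + 1) by rewrite ler_wpM2l // ltW.
    by lra.
  have ys2 : (y%:R `^ s) ^+ 2 <= expR 2 * expR (2 * u / 5).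
    have -> : expR 2 * expR (2 * u / 5) = expR (u / 5 + 1) ^+ 2 :> R.
      by rewrite -expRM_natr -expRD; congr expR; field.
    by rewrite ler_pXn2r // nnegrE ?powR_ge0 ?expR_ge0.
  (* Here 9600 = 6 * 40 ^ 2: below, S ^ 2 <= 6 Z b with Z = exp (2 + 2 u / 5), so 9600 Z <= b yields
     40 S <= b. The surplus exp (u / 10) of exp (u / 2) over exp (2 u / 5) pays for 9600 exp 2,
     which fixes the lower bound demanded of u. *)
  have u10 : 96 * 100 * expR 2 <= expR (u / 10).
    by have := expR_ge1Dx (u / 10); lra.
  have bu : 96 * 100 * (expR 2 * expR (2 * u / 5)) <= b.
    apply: le_trans ub.
    have -> : expR (u / 2) = expR (u / 10) * expR (2 * u / 5).
      by rewrite -expRD; congr expR; field.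
    by rewrite mulrA ler_wpM2r ?expR_ge0.
  set S := prime_sum _ _; set Y := (_ `^ s) ^+ 2 in ys2 *.
  set Z := expR 2 * _ in ys2 bu *.
  move=> hS; have Y0 : 0 <= Y by exact: sqr_ge0.
  have h1 : S ^+ 2 <= 2 * Z * (3 * b).
    apply: le_trans hS _; apply: ler_pM; [lra|lra|lra|lra].
  have : 32 * 100 * (S ^+ 2 / 2) <= b ^+ 2.
    by have := ler_wpM2r b0 bu; rewrite -expr2; lra.
  by rewrite expr2 exprMn exprVn; lra.
have E2 : euler y (1 - s) ^+ 2 <= expR (b / 5).
  apply: (@le_trans _ _ (expR (4 * prime_sum y (1 - s)) ^+ 2)).
    rewrite ler_pXn2r ?nnegrE ?expR_ge0 ?(le_trans ler01 (euler_ge1 _ t0)) //.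
    by apply: euler_le_expR; lra.
  by rewrite -expRM_natr ler_expR; lra.
have yi : y%:R^-1 <= expR (- b) by rewrite expRN lef_pV2 ?posrE ?expR_gt0 ?ltr0n.
have EE : expR (- (6 / 5 * b)) * euler y (1 - s) ^+ 2 <= expR (- b).
  apply: (@le_trans _ _ (expR (- (6 / 5 * b)) * expR (b / 5))).
    by rewrite ler_wpM2l ?expR_ge0.
  by rewrite -expRD ler_expR; lra.
move=> h; apply: le_trans h _.
have -> : 5 * ln 2 * expR (- b) = ln 2 * (5 * expR (- b)) by ring.
rewrite ler_wpM2l ?ln_ge0 ?ler1n //.
by lra.
Qed.

Lemma lnln_large (R : realType) (U : R) :
  exists N0 : nat, forall n, (N0 <= n)%N -> U <= ln (ln n%:R).
Proof.
exists (Num.truncn (expR (expR U))).+1 => n nN.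
have hn : expR (expR U) <= n%:R.
  by apply: le_trans (ltW (truncnS_gt _)) _; rewrite ler_nat.
have n0 : 0 < n%:R :> R by apply: lt_le_trans hn; exact: expR_gt0.
have hL : expR U <= ln n%:R by rewrite -[leLHS]expRK ler_ln ?posrE ?expR_gt0.
have L0 : 0 < ln n%:R :> R by apply: lt_le_trans hL; exact: expR_gt0.
by rewrite -[leLHS]expRK ler_ln ?posrE ?expR_gt0.
Qed.

Local Open Scope classical_set_scope.

(** * The limit *)

Definition rate (R : realType) (n : nat) : R :=
  expR (- Num.sqrt (6^-1 * ln n%:R * ln (ln n%:R))).

(** From exp b >= b ^ 2 / 2 = L u / 12. This weak form suffices for convergence and is explicit
    enough for computability. *)
Lemma rate_le (R : realType) (n : nat) :
  6 <= ln (ln n%:R) :> R -> rate R n <= 2 / ln n%:R.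
Proof.
rewrite /rate; set L := ln n%:R; set u := ln L => u6.
have L1 : 1 < L.
  by rewrite ltNge; apply/negP => /ln_le0; rewrite -/u; lra.
set b := Num.sqrt _.
have b2 : b ^+ 2 = 6^-1 * L * u by rewrite sqr_sqrtr // !mulr_ge0 //; lra.
have b0 : 0 <= b by rewrite sqrtr_ge0.
have := expR_ge1Dxn 1 b0; rewrite b2 (_ : 2`!%:R = 2) // => eb.
have Lb : L / 2 <= expR b by nra.
rewrite expRN -[leRHS]invrK lef_pV2 ?posrE ?expR_gt0 ?invr_gt0 ?divr_gt0 //; last lra.
by rewrite invf_div.
Qed.

Lemma growth_rate_lim (R : realType) :
  exists L : R, exists N0 : nat,
    [/\ growth_rate R n @[n --> \oo] --> L, ln 2 / 12 <= L, L <= 2 * ln 2 &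
        forall n, (N0 <= n)%N -> [/\ 6 <= ln (ln n%:R) :> R,
          `|growth_rate R n - L| <= 5 * ln 2 * rate R n &
          growth_rate R n <= 2 * ln 2]].
Proof.
have l20 : 0 < ln (2 : R) by rewrite ln_gt0 // ltr1n.
have [N1 hN1] := lnln_large (96 * 1000 * expR 2 : R).
have e2 : 1 <= expR 2 :> R by have := expR_ge1Dx (2 : R); lra.
pose N0 := maxn 6 N1; pose g := growth_rate R.
have six n : (N0 <= n)%N -> 6 <= ln (ln n%:R) :> R.
  by rewrite geq_max => /andP[_ /hN1]; lra.
have gub n : (N0 <= n)%N -> g n <= 2 * ln 2.
  rewrite geq_max => /andP[n6 _]; have n0 : 0 < n%:R :> R by rewrite ltr0n; lia.
  rewrite /g /growth_rate ler_pdivrMr //.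
  apply: (@le_trans _ _ (n.+1%:R * ln 2)).
    rewrite mulr_natl -lnXn // -natrX ler_ln ?posrE ?ltr0n ?expn_gt0 //.
      by rewrite ler_nat num_maximal_primitive_le.
    exact: num_maximal_primitive_gt0.
  rewrite mulrAC ler_wpM2r ?(ltW l20) // -natrM ler_nat; lia.
have glb n : (N0 <= n)%N -> ln 2 / 12 <= g n.
  rewrite geq_max => /andP[n6 _]; have n0 : 0 < n%:R :> R by rewrite ltr0n; lia.
  rewrite /g /growth_rate ler_pdivlMr //.
  apply: (@le_trans _ _ ((n %/ 6)%:R * ln 2)).
    rewrite -mulrA mulrC ler_wpM2r ?(ltW l20) // mulrC ler_pdivrMr // -natrM ler_nat.
    lia.
  rewrite mulr_natl -lnXn // -natrX ler_ln ?posrE ?ltr0n ?expn_gt0 //.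
    by rewrite ler_nat num_maximal_primitive_ge.
  exact: num_maximal_primitive_gt0.
have cau n N : (N0 <= n)%N -> (n <= N)%N -> `|g n - g N| <= 5 * ln 2 * rate R n.
  by rewrite geq_max => /andP[_ /hN1 h]; exact: growth_rate_cauchy.
have cg : cvgn g.
  apply/cauchy_cvgP/cauchy_exP => e e0.
  (* By [rate_le] the Cauchy error is at most 10 ln 2 / ln n, so ln n must exceed 10 ln 2 / e; the
     added 1 makes the inequality strict. *)
  have [N2 hN2] := lnln_large (ln (10 * ln 2 / e) + 1).
  pose n := maxn N0 N2.
  have n_N0 : (N0 <= n)%N by rewrite leq_maxl.
  have n_N2 : (N2 <= n)%N by rewrite leq_maxr.
  exists (g n); exists n => // N /= nN; rewrite /ball /=.
  apply: le_lt_trans (cau n N n_N0 nN) _.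
  have Lp : 0 < ln n%:R :> R.
    rewrite ltNge; apply/negP => L0; have := six n n_N0; rewrite ln0 //; lra.
  apply: (@le_lt_trans _ _ (5 * ln 2 * (2 / ln n%:R))).
    by rewrite ler_wpM2l ?rate_le ?six // mulr_ge0 // ltW.
  have p0 : 0 < 10 * ln 2 / e by rewrite divr_gt0 // mulr_gt0.
  have : 10 * ln 2 / e < ln n%:R.
    by rewrite -ltr_ln ?posrE //; have := hN2 n n_N2; lra.
  rewrite ltr_pdivrMr // mulrA ltr_pdivrMr //; lra.
exists (lim (g @ \oo)), N0; split => //.
- by apply: (cvgr_to_ge cg); exists N0.
- by apply: (cvgr_to_le cg); exists N0.
- move=> n nN0; split; [exact: six | | exact: gub].
  (* Letting [N] tend to infinity in the Cauchy estimate transfers the rate to the limit. *)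
  have cn : `|g n - g N| @[N --> \oo] --> `|g n - lim (g @ \oo)|.
    by apply: cvg_norm; apply: cvgB => //; exact: cvg_cst.
  by apply: (cvgr_to_le cn); exists n => // N /= nN; exact: cau.
Qed.

Lemma num_maximal_primitiveER (R : realType) (n : nat) : (0 < n)%N ->
  (num_maximal_primitive n)%:R = expR (growth_rate R n) ^+ n.
Proof.
move=> n0; rewrite -expRM_natr /growth_rate divfK ?pnatr_eq0 -?lt0n //.
by rewrite lnK // posrE ltr0n num_maximal_primitive_gt0.
Qed.

Lemma expR_sub_le (R : realType) (x y c : R) :
  x <= c -> y <= c -> `|expR x - expR y| <= expR c * `|x - y|.
Proof.
have main a b : a <= c -> b <= a -> expR a - expR b <= expR c * (a - b).
  move=> ac ba; apply: (@le_trans _ _ (expR a * (a - b))); last first.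
    by rewrite ler_wpM2r ?subr_ge0 // ler_expR.
  have -> : expR b = expR a * expR (b - a) by rewrite -expRD; congr expR; ring.
  have := expR_ge1Dx (b - a); have := expR_gt0 a; nra.
move=> xc yc; have [xy|xy] := leP x y.
  rewrite ler0_norm ?subr_le0 ?ler_expR // ler0_norm ?subr_le0 // !opprB.
  exact: main.
have yx := ltW xy; rewrite ger0_norm ?subr_ge0 ?ler_expR //.
by rewrite ger0_norm ?subr_ge0 //; exact: main.
Qed.

(** * Computability of the limit *)

Lemma recursive1_ex_minn (P : nat -> nat -> bool) (exP : forall k, exists j, P j k) :
  recursive2 P -> recursive1 (fun k => ex_minn (exP k)).
Proof.
move=> rP; apply: recursive_mu (recursive_negb rP) _ _ => [v|v i].
  rewrite !(tnth_nth 0%N) /= !inordK //= -(tnth_nth 0%N v ord0).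
  by case: ex_minnP => j ->.
rewrite !(tnth_nth 0%N) /= !inordK //= -(tnth_nth 0%N v ord0).
case: ex_minnP => j _ minj ij; case Pi: (P _ _) => //.
by have := minj _ Pi; rewrite leqNgt ij.
Qed.

(* [2 * j + 1 > (2 * k + 2) * m ^ (1 / n)] for the least [j] exactly when
   [j / (k + 1)] is [m ^ (1 / n)] rounded to a multiple of [1 / (k + 1)]. *)
Lemma computable_expR_lim (R : realType) (L : R) (N0 : nat) :
  L <= 2 * ln 2 ->
  (forall n, (N0 <= n)%N -> [/\ 6 <= ln (ln n%:R) :> R,
     `|growth_rate R n - L| <= 5 * ln 2 * rate R n &
     growth_rate R n <= 2 * ln 2]) ->
  computable_real (expR L).
Proof.
move=> Lub hN0; have l20 : 0 < ln (2 : R) by rewrite ln_gt0 // ltr1n.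
(* A power of 2 makes ln n = K (k + 1) ln 2 explicit. The error 4 * 5 ln 2 * 2 / ln n, with
   Lipschitz constant 4 = exp (2 ln 2), is then 40 / (K (k + 1)), half of the allowed error once K
   >= 80; rounding takes the other half. The threshold [N0] enters only as a fixed constant. *)
pose K := (80 + N0)%N; pose n k := (2 ^ (K * k.+1))%N.
have n_gt k : (K * k.+1 < n k)%N by exact: ltn_expl.
have n0 k : (0 < n k)%N by rewrite expn_gt0.
(* Raising the comparison to the power [n k] turns it into one between integers, so that it is
   recursive. *)
pose P j k := ((2 * k.+1) ^ n k * num_maximal_primitive (n k) < (2 * j).+1 ^ n k)%N.
have exP k : exists j, P j k.
  set c := ((2 * k.+1) ^ n k * num_maximal_primitive (n k))%N; exists c.
  rewrite /P -/c; apply: (@leq_trans (2 * c).+1); first by lia.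
  by have := leq_pexp2l (ltn0Sn (2 * c)) (n0 k); rewrite expn1.
have rn (k : nat) (f : k.-tuple nat -> nat) : recursive f -> recursive (fun v => n (f v)).
  move=> rf; apply: recursive_exp; first exact: recursive_const.
  by apply: recursive_mul (recursive_S rf); exact: recursive_const.
have rP : recursive2 P.
  have r0 : recursive (fun v : 2.-tuple nat => tnth v (inord 0)) by exact: recursive_proj.
  have r1 : recursive (fun v : 2.-tuple nat => tnth v (inord 1)) by exact: recursive_proj.
  have r2 : recursive (fun v : 2.-tuple nat => 2%N) by exact: recursive_const.
  apply: recursive_leq; last first.
    by apply: recursive_exp (rn _ _ r1); exact/recursive_S/recursive_mul.
  apply: recursive_S; apply: recursive_mul.
    by apply: recursive_exp (rn _ _ r1); exact/recursive_mul/recursive_S.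
  exact: recursive_num_maximal_primitive (rn _ _ r1).
exists (fun k => ex_minn (exP k)), (fun=> 0%N); split.
- exact: recursive1_ex_minn.
- exact: recursive_const.
move=> k; rewrite subr0; case: ex_minnP => j Pj minj.
have N0n : (N0 <= n k)%N.
  apply: leq_trans (ltnW (n_gt k)); apply: leq_trans (leq_pmulr K (ltn0Sn k)).
  by rewrite leq_addl.
have [u6 hL gub] := hN0 (n k) N0n.
have k0 : 0 < k.+1%:R :> R by rewrite ltr0n.
set x := expR (growth_rate R (n k)).
have xE : x ^+ n k = (num_maximal_primitive (n k))%:R.
  by rewrite num_maximal_primitiveER.
have x0 : 0 <= x by exact: expR_ge0.
have PE i : P i k = (2 * k.+1%:R * x < (2 * i).+1%:R).
  rewrite -(ltr_pXn2r (n0 k)) ?nnegrE ?mulr_ge0 // exprMn xE.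
  by rewrite -[2 * _]natrM -!natrX -natrM ltr_nat.
have lnn : ln (n k)%:R = (K * k.+1)%:R * ln 2 :> R.
  by rewrite natrX lnXn // mulr_natl.
have near : `|expR L - x| <= 2^-1 * k.+1%:R^-1.
  apply: le_trans (expR_sub_le Lub gub) _; rewrite distrC.
  have -> : expR (2 * ln 2) = 4 :> R by rewrite expRM_natl lnK ?posrE //; ring.
  have r2 := rate_le u6.
  apply: (@le_trans _ _ (4 * (5 * ln 2 * (2 / ln (n k)%:R)))).
    rewrite ler_wpM2l //; apply: le_trans hL _.
    by rewrite ler_wpM2l // mulr_ge0 // ltW.
  have K80 : 80 <= K%:R :> R by rewrite ler_nat leq_addr.
  have Kp : 0 < K%:R :> R by lra.
  have -> : 4 * (5 * ln 2 * (2 / ln (n k)%:R)) = 40 / K%:R * k.+1%:R^-1 :> R.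
    by rewrite lnn natrM; field; rewrite !lt0r_neq0.
  rewrite ler_wpM2r ?invr_ge0 // ler_pdivrMr //; lra.
have jx : `|x - j%:R / k.+1%:R| <= 2^-1 * k.+1%:R^-1.
  have -> : x - j%:R / k.+1%:R = (k.+1%:R * x - j%:R) * k.+1%:R^-1.
    by field; exact: lt0r_neq0.
  rewrite normrM (ger0_norm (x := k.+1%:R^-1)) ?invr_ge0 //.
  rewrite ler_wpM2r ?invr_ge0 // ler_norml; apply/andP; split.
    case: j Pj minj => [_ _|j _ minj].
      have : 0 <= k.+1%:R * x by rewrite mulr_ge0.
      lra.
    have : ~~ P j k by apply/negP => /minj; rewrite ltnn.
    rewrite PE -leNgt -[(2 * j).+1%:R]natr1 natrM -[j.+1%:R]natr1; lra.
  by move: Pj; rewrite PE -[(2 * j).+1%:R]natr1 natrM; lra.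
have -> : expR L - j%:R / k.+1%:R = (expR L - x) + (x - j%:R / k.+1%:R) by ring.
apply: le_trans (ler_normD _ _) _; apply: le_trans (lerD near jx) _.
set z := k.+1%:R^-1; lra.
Qed.

Theorem theorem2p4 (R : realType) :
  exists eta : R,
    [/\ (num_maximal_primitive n)%:R `^ n%:R^-1 @[n --> \oo] --> eta,
        forall eps : R, 0 < eps ->
          exists2 err : nat -> R,
            err =O_\oo (fun n : nat =>
              expR (- Num.sqrt ((6^-1 - eps) * ln n%:R * ln (ln n%:R)))) &
            \forall n \near \oo,
              (num_maximal_primitive n)%:R = eta `^ (n%:R * (1 + err n))
      & computable_real eta].
Proof.
have [L [N0 [gL Llb Lub hN0]]] := growth_rate_lim R.
have l20 : 0 < ln (2 : R) by rewrite ln_gt0 // ltr1n.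
have Lp : 0 < L by lra.
exists (expR L); split.
- have -> : (fun n => (num_maximal_primitive n)%:R `^ n%:R^-1) =
            (fun n => expR (growth_rate R n)).
    apply/funext => n; rewrite /powR pnatr_eq0 gtn_eqF ?num_maximal_primitive_gt0 //.
    by rewrite /growth_rate mulrC.
  by apply: continuous_cvg gL; exact: continuous_expR.
(* The choice is forced: equality of logarithms reads n g(n) = n (1 + err n) L, where g is the
   growth rate and L > 0. *)
- move=> eps eps0; exists (fun n => growth_rate R n / L - 1).
    apply/eqO_exP; exists (5 * ln 2 / L); first by rewrite divr_gt0 // mulr_gt0.
    exists N0 => // n /= N0n; have [u6 hL _] := hN0 n N0n.
    have -> : growth_rate R n / L - 1 = (growth_rate R n - L) / L.
      by field; exact: lt0r_neq0.
    rewrite normrM normfV (gtr0_norm Lp) (ger0_norm (expR_ge0 _)).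
    rewrite ler_pdivrMr // mulrAC divfK ?lt0r_neq0 //.
    apply: le_trans hL _; rewrite ler_wpM2l ?mulr_ge0 ?(ltW l20) //.
    (* Lowering 1 / 6 to 1 / 6 - eps only enlarges the bound. If eps > 1 / 6 the radicand is
       negative and its square root is 0, which monotonicity covers as well. *)
    rewrite ler_expR lerN2; apply: ler_wsqrtr.
    have L1 : 1 < ln n%:R :> R.
      by rewrite ltNge; apply/negP => /ln_le0; lra.
    rewrite ler_wpM2r ?(le_trans _ u6) // ler_wpM2r ?(le_trans _ (ltW L1)) //.
    by rewrite gerBl ltW.
  exists N0.+1 => // n /= N0n.
  have n0 : (0 < n)%N by exact: leq_trans N0n.
  rewrite (num_maximal_primitiveER R n0) /powR gt_eqF ?expR_gt0 // expRK.
  rewrite -expRM_natr; congr expR; field; exact: lt0r_neq0.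
- exact: computable_expR_lim Lub hN0.
Qed.
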